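(* Let $P:C(B_n)\to\Pi_1(\mathbb R^n)$ be an interpolation projector with nodes $x^{(1)},\dots,x^{(n+1)}\in B_n$, let $S$ be the simplex with these vertices and $A$ its vertex matrix. Then $$\|P\|_{B_n}\ge\chi_n^{-1}\Big(\frac{\varkappa_n}{\mathrm{vol}(S)}\Big)=\chi_n^{-1}\Big(\frac{n!\,\varkappa_n}{|\det A|}\Big).$$ Consequently $\theta_n(B_n)\ge\chi_n^{-1}(\varkappa_n/\sigma_n)$.
   Context: $B_n$ is the closed unit Euclidean ball in $\mathbb R^n$, $\varkappa_n=\mathrm{vol}(B_n)$, and $\sigma_n$ is the volume of a regular $n$-simplex inscribed into $B_n$. $C(B_n)$ has the sup norm, $\Pi_1(\mathbb R^n)$ is the space of polynomials of degree $\le1$; the interpolation projector with nodes $x^{(j)}$ (vertices of a nondegenerate simplex) maps $f$ to the unique $p\in\Pi_1$ with $p(x^{(j)})=f(x^{(j)})$; $\|P\|_{B_n}$ is its operator norm and $\theta_n(B_n)$ is the minimum of $\|P\|_{B_n}$ over all such projectors. The vertex matrix $A$ has rows $(x^{(j)}_1,\dots,x^{(j)}_n,1)$. $\chi_n(t)=\frac{1}{2^nn!}\frac{d^n}{dt^n}(t^2-1)^n$ is the standardized Legendre polynomial, which is increasing on $[1,\infty)$ with $\chi_n(1)=1$; $\chi_n^{-1}$ denotes its inverse on $[1,\infty)$. *)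

(* Defs.v *)
From HB Require Import structures.
From mathcomp Require Import all_boot all_order all_algebra.
From mathcomp Require Import all_classical all_reals all_analysis.
Set Implicit Arguments. Unset Strict Implicit. Unset Printing Implicit Defensive.
Import Order.TTheory GRing.Theory Num.Theory.
Import numFieldNormedType.Exports.
Local Open Scope classical_set_scope.
Local Open Scope ring_scope.

Section Defs.
Variable R : realType.

Definition unit_ball (n : nat) : set 'rV[R]_n :=
  [set y | \sum_(i < n) (y 0 i) ^+ 2 <= 1].
Arguments unit_ball n : clear implicits.

Definition ext_row (n : nat) (y : 'rV[R]_n) : 'rV[R]_n.+1 :=
  \row_(k < n.+1) (if unlift ord_max k is Some k' then y 0 k' else 1).

Definition vertex_matrix (n : nat) (x : 'I_n.+1 -> 'rV[R]_n) : 'M[R]_n.+1 :=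
  \matrix_(j < n.+1) ext_row (x j).

(* The interpolation projector: P f is the affine polynomial y |-> ext_row y . c
   whose coefficient vector c solves A c = (f(x^(j)))_j, i.e. the unique
   p in Pi_1 with p(x^(j)) = f(x^(j)) (when det A <> 0). *)
Definition interp (n : nat) (x : 'I_n.+1 -> 'rV[R]_n) (f : 'rV[R]_n -> R)
    (y : 'rV[R]_n) : R :=
  (ext_row y *m invmx (vertex_matrix x) *m \col_(j < n.+1) f (x j)) 0 0.

Definition interp_norm (n : nat) (x : 'I_n.+1 -> 'rV[R]_n) : R :=
  sup [set v | exists (f : 'rV[R]_n -> R) (y : 'rV[R]_n),
     [/\ {within (unit_ball n), continuous f},
         (forall z, unit_ball n z -> `|f z| <= 1),
         unit_ball n y & v = `|interp x f y|]].

Definition theta (n : nat) : R :=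
  inf [set v | exists x : 'I_n.+1 -> 'rV[R]_n,
     [/\ (forall j, unit_ball n (x j)), \det (vertex_matrix x) != 0 &
         v = interp_norm x]].

Definition simplex_hull (n : nat) (x : 'I_n.+1 -> 'rV[R]_n) : set 'rV[R]_n :=
  [set y | exists l : 'I_n.+1 -> R,
     [/\ (forall j, 0 <= l j), \sum_j l j = 1 & y = \sum_j l j *: x j]].

(* Volume (Jordan content) of a set K contained in the cube [-1,1]^n:
   limit of (number of points of the grid (1/m) Z^n in K) / m^n. *)
Definition grid_pt (n m : nat) (k : {ffun 'I_n -> 'I_(2 * m).+1}) : 'rV[R]_n :=
  \row_(i < n) (((k i : nat)%:R - m%:R) / m%:R).

Definition grid_count (n : nat) (K : set 'rV[R]_n) (m : nat) : nat :=
  #|[set k : {ffun 'I_n -> 'I_(2 * m).+1} | `[< K (grid_pt k) >]]|.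

Definition vol (n : nat) (K : set 'rV[R]_n) : R :=
  limn (fun m : nat => ((grid_count K m)%:R / (m%:R ^+ n) : R)).

Definition kappa (n : nat) : R := vol (unit_ball n).

(* standardized Legendre polynomial chi_n = 1/(2^n n!) d^n/dt^n (t^2-1)^n *)
Definition chi (n : nat) : {poly R} :=
  (2%:R ^+ n * (n`!)%:R)^-1 *: (('X ^+ 2 - 1) ^+ n)^`(n).

Definition chi_inv (n : nat) (s : R) : R :=
  sup [set t | 1 <= t /\ (chi n).[t] <= s].

Definition regular_inscribed (n : nat) (x : 'I_n.+1 -> 'rV[R]_n) : Prop :=
  [/\ (forall j, \sum_(i < n) (x j 0 i) ^+ 2 = 1),
      (forall j k j' k', j != k -> j' != k' ->
          \sum_(i < n) (x j 0 i - x k 0 i) ^+ 2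
        = \sum_(i < n) (x j' 0 i - x k' 0 i) ^+ 2)
    & \det (vertex_matrix x) != 0].

End Defs.
Arguments unit_ball {R} n.

(* Main.v *)
Require Import Defs.
From HB Require Import structures.
From mathcomp Require Import all_boot all_order all_algebra.
From mathcomp Require Import all_classical all_reals all_analysis.
From mathcomp Require Import fingroup perm ring lra zify.
Import Order.TTheory GRing.Theory Num.Theory.
Import numFieldNormedType.Exports.
Local Open Scope classical_set_scope.
Local Open Scope ring_scope.
Set Implicit Arguments. Unset Strict Implicit. Unset Printing Implicit Defensive.

(** If g is the norm of the projector, the ball lies in the body E_g of all points
    whose barycentric coordinates l_0, ..., l_n satisfy |l_0| + ... + |l_n| <= g.
    Since the l_j add up to 1, this means that, among any n of the coordinates,
    the positive parts add up to at most 1 + s and the negative parts to at most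
    s, where g = 1 + 2 s.  Choosing which k of these coordinates are negative, the
    volume of E_g relative to vol(S) is
    n! sum_k C(n,k) s^k/k! (1+s)^(n-k)/(n-k)!, and by Rodrigues' formula and the
    Leibniz rule this is chi_n(g).  Hence kappa_n <= chi_n(g) vol(S).

    Volumes are limits of lattice point counts, so |det| must come out of
    counting: a map that changes one coordinate t into d t + l(others) alters the
    number of lattice points on each line of a convex set by the factor 1/|d| up
    to a bounded error, and the LUP decomposition writes every invertible matrix
    as a product of such maps and of permutations.

    For the bound on theta_n, Hadamard's inequality for the Gram matrix
    <x_i, x_j> + 1/n shows that the regular inscribed simplex maximizes |det A|. *)

(** * Integer points in intervals *)

Section IntervalCount.
Variable R : realType.
Implicit Types (J : set R) (a b d s : R).

(** Membership of the endpoints is left open, so that bounded intervals of every type and the empty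
    set (with a = b) are treated alike. *)
Definition nearly_itv J a b :=
  [/\ a <= b, (forall u, J u -> a <= u <= b) & (forall u, a < u < b -> J u)].

Definition slice_convex J :=
  forall u v w, J u -> J w -> u <= v <= w -> J v.

Lemma slice_convex_nearly_itv J c : 
  slice_convex J -> (forall u, J u -> - c <= u <= c) ->
  exists a b, nearly_itv J a b.
Proof.
move=> cJ bJ; case: (pselect (exists u, J u)) => [[u0 Ju0]|nJ]; last first.
  exists 0, 0; split=> [//|u Ju|u]; first by case: nJ; exists u.
  by move=> /andP[/lt_trans h /h]; rewrite ltxx.
have hi : has_inf J by split; [exists u0|exists (- c) => u /bJ /andP[]].
have hs : has_sup J by split; [exists u0|exists c => u /bJ /andP[]].
exists (inf J), (sup J); split.
- apply: (@le_trans _ _ u0); first by apply: ge_inf => //; case: hi.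
  by apply: ub_le_sup => //; case: hs.
- move=> u Ju; apply/andP; split; first by apply: ge_inf => //; case: hi.
  by apply: ub_le_sup => //; case: hs.
- move=> u /andP[iu us].
  have [v Jv vu] := inf_lt (proj1 hi) iu; have [w Jw uw] := sup_gt (proj1 hs) us.
  by apply: (cJ v u w) => //; rewrite !ltW.
Qed.

Definition clamp a b u : R := if u <= a then a else if u <= b then u else b.

Lemma clamp_step a b u : a <= b -> let d := clamp a b (u + 1) - clamp a b u in
  [/\ 0 <= d <= 1, u + 1 <= a \/ b <= u -> d = 0 & a <= u -> u + 1 <= b -> d = 1].
Proof.
rewrite /clamp => ab /=; split=> [|[]|].
- by apply/andP; split; do ?case: ifP => ?; lra.
- by do ?case: ifP => ?; lra.
- by do ?case: ifP => ?; lra.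
- by do ?case: ifP => ?; lra.
Qed.

(* Each indicator is compared with the increment over [u, u + 1] of a clamping
   function, so that the sum telescopes. *)
Lemma card_nearly_itv J a b (N : nat) : nearly_itv J a b ->
  (forall u, J u -> - N%:R <= u <= N%:R) ->
  `|\sum_(t < (2 * N).+1) (`[<J (t%:R - N%:R)>] : nat)%:R - (b - a)| <= 1.
Proof.
move=> [ab Jab abJ] bJ; rewrite -(big_mkord xpredT
  (fun t : nat => (`[<J (t%:R - N%:R)>] : nat)%:R : R)).
have tel p q : \sum_(0 <= t < (2 * N).+1)
    (clamp p q (t%:R - N%:R + 1) - clamp p q (t%:R - N%:R)) =
    clamp p q (N%:R + 1) - clamp p q (- N%:R).
  under eq_bigr do rewrite addrAC natr1.
  rewrite (@telescope_sumr R 0 _ (fun t => clamp p q (t%:R - N%:R))) //.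
  by congr (clamp _ _ _ - clamp _ _ _); rewrite -?natr1 ?natrM; ring.
rewrite ler_norml; apply/andP; split; last first.
  (* Upper bound: clamping to [a, b + 1] has increment 1 at each u in [a, b], and it grows by at
     most b + 1 - a in total. *)
  have ab1 : a <= b + 1 by lra.
  rewrite lerBlDl; apply: (@le_trans _ _ (\sum_(0 <= t < (2 * N).+1)
    (clamp a (b + 1) (t%:R - N%:R + 1) - clamp a (b + 1) (t%:R - N%:R)))); last first.
    by rewrite tel /clamp; do ?case: ifP => ?; lra.
  apply: ler_sum_nat => t _; have [/andP[d0 _] _ d1] := clamp_step (t%:R - N%:R) ab1.
  by case: asboolP => [/Jab /andP[? ?]|//]; rewrite d1// lerD2r.
(* Lower bound: clamping to [a + 1, b] increases over [u, u + 1] only if a < u < b. Once a and b are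
   known to lie in [-N, N], the telescoped sum is the full length b - a - 1. *)
rewrite lerBrDl; have [ab1|ab1] := lerP (a + 1) b; last first.
  by apply: (@le_trans _ _ 0); [lra|apply: sumr_ge0].
have aN : - N%:R <= a.
  rewrite leNgt; apply/negP => h; have [hb|hb] := lerP (- N%:R : R) b.
    have /abJ/bJ /andP[] : a < (a - N%:R) / 2 < b by apply/andP; split; lra.
    by lra.
  have /abJ/bJ /andP[] : a < (a + b) / 2 < b by apply/andP; split; lra.
  by lra.
have bN : b <= N%:R.
  rewrite leNgt; apply/negP => h; have [ha|ha] := lerP a (N%:R : R).
    have /abJ/bJ /andP[] : a < (b + N%:R) / 2 < b by apply/andP; split; lra.
    by lra.
  have /abJ/bJ /andP[] : a < (a + b) / 2 < b by apply/andP; split; lra.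
  by lra.
apply: (@le_trans _ _ (\sum_(0 <= t < (2 * N).+1)
    (clamp (a + 1) b (t%:R - N%:R + 1) - clamp (a + 1) b (t%:R - N%:R)))).
  by rewrite tel /clamp; do ?case: ifP => ?; lra.
apply: ler_sum_nat => t _; have [/andP[_ d1] d0 _] := clamp_step (t%:R - N%:R) ab1.
case: asboolP => // nJ; rewrite d0// lerD2r.
have [|h1] := lerP (t%:R - N%:R : R) a; first by left.
have [|h2] := lerP b (t%:R - N%:R : R); first by right.
by case: nJ; apply: abJ; rewrite h1.
Qed.

Lemma nearly_itv_comp J a b d s : nearly_itv J a b -> d != 0 ->
  exists a' b', nearly_itv [set u | J (d * u + s)] a' b' /\ `|d| * (b' - a') = b - a.
Proof.
move=> [ab Jab abJ] d0.
have dK u : d * u / d = u by rewrite mulrAC mulfV ?mul1r.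
have [dp|dn] : 0 < d \/ d < 0 by move: d0; rewrite neq_lt => /orP[]; [right|left].
  exists ((a - s) / d), ((b - s) / d); split; last first.
    by rewrite gtr0_norm// -mulrBl mulrC divfK//; ring.
  split; first by rewrite ler_pM2r ?invr_gt0//; lra.
    move=> u /= /Jab /andP[? ?]; rewrite ler_pdivrMr// ler_pdivlMr//; lra.
  move=> u; rewrite ltr_pdivrMr// ltr_pdivlMr// => /andP[? ?] /=.
  by apply: abJ; lra.
exists ((b - s) / d), ((a - s) / d); split; last first.
  by rewrite ltr0_norm// -mulrBl mulrC mulrN divfK//; ring.
split; first by rewrite ler_nM2r ?invr_lt0//; lra.
  move=> u /= /Jab /andP[? ?]; rewrite ler_ndivrMr// ler_ndivlMr//; lra.
move=> u; rewrite ltr_ndivrMr// ltr_ndivlMr// => /andP[? ?] /=.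
by apply: abJ; lra.
Qed.

(** Each count is within 1 of the length of its interval, and the lengths differ exactly by the
    factor |d|; the errors add up to |d| + 1. *)
Lemma card_slice_comp J d s (N : nat) : slice_convex J -> d != 0 ->
  (forall u, J u -> - N%:R <= u <= N%:R) ->
  (forall u, J (d * u + s) -> - N%:R <= u <= N%:R) ->
  `| `|d| * \sum_(t < (2 * N).+1) (`[<J (d * (t%:R - N%:R) + s)>] : nat)%:R
     - \sum_(t < (2 * N).+1) (`[<J (t%:R - N%:R)>] : nat)%:R| <= `|d| + 1.
Proof.
move=> cJ d0 bJ bJ'; have [a [b Jab]] := slice_convex_nearly_itv cJ bJ.
have [a' [b' [Jab' lenE]]] := nearly_itv_comp s Jab d0.
have := card_nearly_itv Jab bJ; have := card_nearly_itv Jab' bJ' => /=.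
move: (\sum_(_ < _) _) => x; move: (\sum_(_ < _) _) => y hx hy.
have -> : `|d| * x - y = `|d| * (x - (b' - a')) - (y - (b - a)) by rewrite -lenE; ring.
apply: (le_trans (ler_normB _ _)); rewrite lerD// normrM normr_id.
by rewrite -[leRHS]mulr1 ler_wpM2l.
Qed.

End IntervalCount.

(** * Lattice points under linear maps and translations *)

Section LatticeCount.
Variable R : realType.

Definition lattice_pt n N (k : {ffun 'I_n -> 'I_(2 * N).+1}) : 'rV[R]_n :=
  \row_i ((k i)%:R - N%:R).

(** Only the cube [-N, N]^n is searched, which is why comparisons of counts carry box hypotheses. *)
Definition lattice_count n N (K : set 'rV[R]_n) : R :=
  \sum_(k : {ffun 'I_n -> 'I_(2 * N).+1}) (`[<K (lattice_pt k)>] : nat)%:R.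

Definition in_box n (r : R) (K : set 'rV[R]_n) :=
  forall x, K x -> forall i, `|x 0 i| <= r.

Definition row_convex n (K : set 'rV[R]_n) :=
  forall x y t, K x -> K y -> 0 <= t <= 1 -> K (t *: x + (1 - t) *: y).

Definition ffun_insert n (T : finType) (j : 'I_n.+1) (t : T) (k : {ffun 'I_n -> T}) :
  {ffun 'I_n.+1 -> T} := [ffun i => oapp k t (unlift j i)].

(** A discrete Fubini theorem, used to cut the cube into lines parallel to axis j. *)
Lemma sum_ffun_insert n (T : finType) (j : 'I_n.+1) (V : zmodType)
    (F : {ffun 'I_n.+1 -> T} -> V) :
  \sum_k F k = \sum_(k : {ffun 'I_n -> T}) \sum_t F (ffun_insert j t k).
Proof.
rewrite pair_big (reindex (fun p => ffun_insert j p.2 p.1)) //=.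
exists (fun k => ([ffun i => k (lift j i)], k j)) => [[k t]|k] _ /=.
  congr pair; last by rewrite ffunE unlift_none.
  by apply/ffunP => i; rewrite !ffunE liftK.
apply/ffunP => i; rewrite ffunE; case: unliftP => [i' ->|->] //=.
by rewrite ffunE.
Qed.

Definition set_coord n (j : 'I_n) (u : R) (x : 'rV[R]_n) : 'rV[R]_n :=
  \row_i (if i == j then u else x 0 i).

Lemma set_coord_convex n (j : 'I_n) (x : 'rV[R]_n) (K : set 'rV[R]_n) :
  row_convex K -> slice_convex [set u | K (set_coord j u x)].
Proof.
move=> cK u v w /= Ku Kw /andP[uv vw].
have [uw|/eqP uw] := eqVneq u w.
  by have -> : v = u by apply/eqP; rewrite eq_le uv uw vw.
have uw0 : 0 < w - u.
  by rewrite subr_gt0 lt_neqAle (le_trans uv vw) andbT; apply/eqP.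
have := cK _ _ ((w - v) / (w - u)) Ku Kw.
have -> : 0 <= (w - v) / (w - u) <= 1.
  by rewrite divr_ge0 ?subr_ge0 ?(le_trans uv vw) //= ler_pdivrMr // mul1r lerB.
move=> /(_ isT).
congr K; apply/rowP => i; rewrite !mxE; case: eqP => _; last by ring.
by field; rewrite gt_eqF.
Qed.

(** Since l ignores coordinate j, it is constant on each line parallel to axis j, where
    [card_slice_comp] applies with error |d| + 1. There are (2N + 1)^n such lines. *)
Lemma column_count n (j : 'I_n.+1) N d (l : 'rV[R]_n.+1 -> R) (K K' : set 'rV[R]_n.+1) :
  row_convex K -> d != 0 -> in_box N%:R K -> in_box N%:R K' ->
  (forall u x, l (set_coord j u x) = l x) ->
  (forall x, K' x <-> K (set_coord j (d * x 0 j + l x) x)) ->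
  `| `|d| * lattice_count N K' - lattice_count N K| <= (`|d| + 1) * ((2 * N).+1%:R) ^+ n.
Proof.
move=> cK d0 bK bK' lE K'E; rewrite /lattice_count !(sum_ffun_insert j) mulr_sumr -sumrB.
apply: (le_trans (ler_norm_sum _ _ _)).
have -> : (`|d| + 1) * ((2 * N).+1%:R) ^+ n =
    \sum_(k : {ffun 'I_n -> 'I_(2 * N).+1}) (`|d| + 1).
  by rewrite sumr_const card_ffun !card_ord -[RHS]mulr_natr natrX.
apply: ler_sum => k _; pose x0 := lattice_pt (ffun_insert j ord0 k).
have ptE t : lattice_pt (ffun_insert j t k) = set_coord j (t%:R - N%:R) x0.
  apply/rowP => i; rewrite !mxE !ffunE; case: eqP => [->|]; first by rewrite unlift_none.
  by case: unliftP => [i' -> //|-> /(_ erefl)].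
have scK u v : set_coord j u (set_coord j v x0) = set_coord j u x0.
  by apply/rowP => i; rewrite !mxE; case: (i == j).
have sc0 u : (set_coord j u x0) 0 j = u by rewrite !mxE eqxx.
pose J := [set u | K (set_coord j u x0)].
have bnd (u : R) x : `|u| <= x -> - x <= u <= x by rewrite ler_norml.
have := @card_slice_comp R J d (l x0) N (set_coord_convex cK) d0 _ _.
move=> H; apply: le_trans (H _ _); last 2 first.
- by move=> u /bK /(_ j); rewrite sc0; exact: bnd.
- move=> u Ku; apply: bnd; rewrite -(sc0 u); apply: bK'.
  by apply/K'E; rewrite sc0 lE scK.
rewrite le_eqVlt; apply/orP; left; apply/eqP; congr (`| _ * _ - _ |).
  apply: eq_bigr => t _; congr ((nat_of_bool _)%:R); apply: asbool_equiv_eq.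
  by rewrite ptE; apply: (iff_trans (K'E _)); rewrite sc0 lE scK.
by apply: eq_bigr => t _; rewrite ptE.
Qed.

Lemma row_convex_preim n m (A : 'M[R]_(n, m)) (K : set 'rV[R]_m) :
  row_convex K -> row_convex [set x | K (x *m A)].
Proof.
by move=> cK x y t /= Kx Ky /(cK _ _ _ Kx Ky); rewrite mulmxDl !scalemxAl.
Qed.

(** A crude bound for the operator norm with respect to the sup norm. *)
Definition entry_sum n m (A : 'M[R]_(n, m)) := \sum_i \sum_j `|A i j|.

Lemma entry_sum_ge0 n m (A : 'M[R]_(n, m)) : 0 <= entry_sum A.
Proof. by apply: sumr_ge0 => i _; apply: sumr_ge0. Qed.

Lemma mulmx_entry_le n m (A : 'M[R]_(n, m)) (x : 'rV[R]_n) r j :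
  0 <= r -> (forall i, `|x 0 i| <= r) -> `|(x *m A) 0 j| <= entry_sum A * r.
Proof.
move=> r0 xr; rewrite mxE; apply: (le_trans (ler_norm_sum _ _ _)).
rewrite /entry_sum mulr_suml; apply: ler_sum => i _.
rewrite normrM mulrC ler_pM//.
by rewrite (bigD1 j)//= lerDl; apply: sumr_ge0.
Qed.

Lemma in_box_preim n (A : 'M[R]_n) (K : set 'rV[R]_n) r :
  A \in unitmx -> 0 <= r -> in_box r K ->
  in_box (entry_sum (invmx A) * r) [set x | K (x *m A)].
Proof.
move=> uA r0 bK x /= /bK xr i; rewrite -[x](mulmxK uA).
exact: mulmx_entry_le.
Qed.

Lemma in_box_le n (K : set 'rV[R]_n) r s : r <= s -> in_box r K -> in_box s K.
Proof. by move=> rs bK x Kx i; apply: le_trans rs; apply: bK. Qed.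

(** A quantitative change of variables formula: the error has order N^n, while counts can have order
    N^(n+1). Uniformity in K makes the property stable under composition, and b makes the cube large
    enough for K and its preimage. *)
Definition count_scales n (A : 'M[R]_n.+1) := exists C b, forall r N (K : set 'rV[R]_n.+1),
  0 <= r -> row_convex K -> in_box r K -> b * r <= N%:R ->
  `| `|\det A| * lattice_count N [set x | K (x *m A)] - lattice_count N K|
    <= C * ((2 * N).+1%:R) ^+ n.

Lemma count_scalesM n (A B : 'M[R]_n.+1) : B \in unitmx ->
  count_scales A -> count_scales B -> count_scales (A *m B).
Proof.
move=> uB [CA [bA hA]] [CB [bB hB]].
pose e := entry_sum (invmx B).
(* The estimate for A is applied to the preimage of K under B, which lies in a box of radius e r;
   absolute values let the sum dominate both size requirements. *)
exists (`|\det B| * CA + CB), (`|bA * e| + `|bB|) => r N K r0 cK bK bN.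
have /hA : 0 <= e * r by rewrite mulr_ge0// entry_sum_ge0.
move/(_ N [set x | K (x *m B)] (row_convex_preim cK) (in_box_preim uB r0 bK)).
move=> /= HA.
have {}HA := HA (le_trans _ bN).
have {}HB := hB r N K r0 cK bK (le_trans _ bN).
rewrite det_mulmx normrM.
under [X in lattice_count N X]eq_set do rewrite mulmxA.
set x := lattice_count N _ in HA *; set y := lattice_count N _ in HA HB *.
set z := lattice_count N K in HB *.
have -> : `|\det A| * `|\det B| * x - z =
    `|\det B| * (`|\det A| * x - y) + (`|\det B| * y - z) by ring.
apply: (le_trans (ler_normD _ _)); rewrite mulrDl lerD//; last first.
  by apply: HB; rewrite mulrDl ler_wpDl ?mulr_ge0// ler_wpM2r// ler_norm.
rewrite normrM normr_id -mulrA ler_wpM2l// HA//.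
by rewrite mulrDl mulrA ler_wpDr ?mulr_ge0// ler_wpM2r// ler_norm.
Qed.

(** A permutation of coordinates permutes the lattice points of the cube, so there is no error at
    all. *)
Lemma count_scales_perm n (s : {perm 'I_n.+1}) : count_scales (perm_mx s).
Proof.
exists 0, 0 => r N K _ _ _ _; rewrite det_perm normrX normrN1 expr1n mul1r mul0r.
pose T := {ffun 'I_n.+1 -> 'I_(2 * N).+1}.
rewrite [lattice_count N K](reindex (fun k : T => [ffun i => k (s^-1%g i)] : T)); last first.
  exists (fun k : T => [ffun i => k (s i)]) => k _; apply/ffunP => i.
    by rewrite !ffunE permK.
  by rewrite !ffunE permKV.
rewrite /lattice_count -sumrB big1 ?normr0// => k _.
suff E : lattice_pt k *m perm_mx s = lattice_pt [ffun i => k (s^-1%g i)].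
  by rewrite /= E subrr.
by rewrite -[s in perm_mx s]invgK -col_permE; apply/rowP => i; rewrite !mxE ffunE.
Qed.

Definition column_mx n (j : 'I_n) (u : 'cV[R]_n) : 'M[R]_n :=
  \matrix_(i, k) (if k == j then u i 0 else (i == k)%:R).

Lemma mul_column_mx n (j : 'I_n) (u : 'cV[R]_n) (x : 'rV[R]_n) :
  x *m column_mx j u = set_coord j ((x *m u) 0 0) x.
Proof.
apply/rowP => k; rewrite !mxE; case: eqP => [->|/eqP kj].
  by apply: eq_bigr => i _; rewrite mxE eqxx.
rewrite (bigD1 k)//= mxE (negPf kj) eqxx mulr1 big1 ?addr0// => i ik.
by rewrite mxE (negPf kj) (negPf ik) mulr0.
Qed.

(** The cofactors along column j do not see that column, hence agree with those of the identity. *)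
Lemma det_column_mx n (j : 'I_n) (u : 'cV[R]_n) : \det (column_mx j u) = u j 0.
Proof.
rewrite (expand_det_col _ j) (bigD1 j)//= big1 ?addr0 => [|i ij].
  have -> : cofactor (column_mx j u) j j = cofactor (1%:M) j j.
    rewrite /cofactor; congr (_ * \det _); apply/matrixP => a b.
    by rewrite !mxE eq_sym (negPf (neq_lift _ _)).
  have /matrixP /(_ j j) := mul_mx_adj (1%:M : 'M[R]_n).
  by rewrite mul1mx det1 !mxE eqxx => ->; rewrite mulr1.
have -> : cofactor (column_mx j u) i j = cofactor (1%:M) i j.
  rewrite /cofactor; congr (_ * \det _); apply/matrixP => a b.
  by rewrite !mxE eq_sym (negPf (neq_lift _ _)).
have /matrixP /(_ j i) := mul_mx_adj (1%:M : 'M[R]_n).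
by rewrite mul1mx det1 !mxE eq_sym (negPf ij) => ->; rewrite mulr0.
Qed.

Lemma count_scales_column n (j : 'I_n.+1) (u : 'cV[R]_n.+1) :
  u j 0 != 0 -> count_scales (column_mx j u).
Proof.
move=> u0; rewrite /count_scales det_column_mx.
have uC : column_mx j u \in unitmx by rewrite unitmxE det_column_mx unitfE.
(* In the second witness, 1 accounts for the box of K and the entry sum for the box of its
   preimage. *)
exists (`|u j 0| + 1), (1 + entry_sum (invmx (column_mx j u))).
move=> r N K r0 cK bK bN.
apply: (@column_count _ j _ _ (fun x => \sum_(i | i != j) x 0 i * u i 0)) => //.
- by apply: in_box_le bK; apply: le_trans bN; rewrite ler_peMl// lerDl entry_sum_ge0.
- apply: in_box_le (in_box_preim uC r0 bK); apply: le_trans bN.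
  by rewrite ler_wpM2r// lerDr.
- by move=> v x; apply: eq_bigr => i ij; rewrite mxE (negPf ij).
- by move=> x /=; rewrite mul_column_mx mxE (bigD1 j)//= [u j 0 * _]mulrC.
Qed.

Lemma count_scales1 n : count_scales (1%:M : 'M[R]_n.+1).
Proof. by rewrite -perm_mx1; exact: count_scales_perm. Qed.

(** Where u has a nonzero entry, V' has a unit column; hence V' u = u, and V factors as V' times
    [column_mx j u]. *)
Lemma count_scales_replace_column n (V V' : 'M[R]_n.+1) (j : 'I_n.+1) (u : 'cV[R]_n.+1) :
  u j 0 != 0 -> (forall k, u k 0 != 0 -> forall i, V' i k = (i == k)%:R) ->
  (forall i k, V i k = if k == j then u i 0 else V' i k) ->
  count_scales V' -> count_scales V.
Proof.
move=> u0 uV' VE cV'; rewrite (_ : V = V' *m column_mx j u); last first.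
  apply/row_matrixP => i; rewrite row_mul mul_column_mx.
  apply/rowP => k; rewrite !mxE VE; case: eqP => // _.
  rewrite (bigD1 i)//= big1 ?addr0 => [|l li]; rewrite mxE.
    have [->|/uV' ->] := eqVneq (u i 0) 0; first by rewrite mulr0.
    by rewrite eqxx mul1r.
  have [->|/uV' ->] := eqVneq (u l 0) 0; first by rewrite mulr0.
  by rewrite eq_sym (negPf li) mul0r.
apply: count_scalesM cV' (count_scales_column u0).
by rewrite unitmxE det_column_mx unitfE.
Qed.

(** Starting from the identity, the columns of U are filled in from last to first. Column j is
    supported on rows up to j, and the columns with these indices are still unit vectors. *)
Lemma count_scales_upper n (U : 'M[R]_n.+1) :
  (forall i j : 'I_n.+1, (j < i)%N -> U i j = 0) -> (forall i, U i i != 0) -> count_scales U.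
Proof.
move=> U0 Ud; pose V m : 'M[R]_n.+1 := \matrix_(i, l) (if (m <= l)%N then U i l else (i == l)%:R).
have -> : U = V 0%N by apply/matrixP => i l; rewrite mxE.
suff H k : (k <= n.+1)%N -> count_scales (V (n.+1 - k)%N).
  by have := H n.+1 (leqnn _); rewrite subnn.
elim: k => [_|k IH kn].
  rewrite subn0 (_ : V _ = 1%:M); first exact: count_scales1.
  by apply/matrixP => i l; rewrite !mxE leqNgt ltn_ord.
pose j : 'I_n.+1 := Ordinal (leq_ltn_trans (leq_subr k n) (ltnSn n)).
apply: (@count_scales_replace_column _ _ (V (n.+1 - k)%N) j (col j U)).
- by rewrite mxE.
- move=> l; rewrite mxE => Ul i; rewrite mxE ifF//; apply/negP => jl.
  by move/eqP: Ul; apply; apply: U0; rewrite /= -ltnS -subSn.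
- move=> i l; rewrite !mxE; have [->|/negPf lj] := eqVneq l j; first by rewrite subSS leqnn.
  by rewrite subSS subSn// ltn_neqAle [_ == _ :> nat]eq_sym [_ == _ :> nat]lj.
- exact: (IH (ltnW kn)).
Qed.

(** The mirror image: column j is supported on rows from j on, so columns are filled in from first
    to last. *)
Lemma count_scales_lower n (L : 'M[R]_n.+1) :
  (forall i j : 'I_n.+1, (i < j)%N -> L i j = 0) -> (forall i, L i i != 0) -> count_scales L.
Proof.
move=> L0 Ld; pose V m : 'M[R]_n.+1 := \matrix_(i, l) (if (l < m)%N then L i l else (i == l)%:R).
have -> : L = V n.+1 by apply/matrixP => i l; rewrite mxE ltn_ord.
elim: {-2}n.+1 (leqnn n.+1) => [_|k IH kn].
  by rewrite (_ : V _ = 1%:M); [exact: count_scales1|apply/matrixP => i l; rewrite !mxE].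
pose j : 'I_n.+1 := Ordinal kn.
apply: (@count_scales_replace_column _ _ (V k) j (col j L)).
- by rewrite mxE.
- move=> l; rewrite mxE => Ll i; rewrite mxE ifF//; apply/negP => jl.
  by move/eqP: Ll; apply; apply: L0.
- move=> i l; rewrite !mxE; have [->|/negPf lj] := eqVneq l j; first by rewrite /= ltnSn.
  by rewrite ltnS leq_eqVlt [_ == _ :> nat]lj.
- exact: (IH (ltnW kn)).
Qed.

Lemma count_scales_unitmx n (A : 'M[R]_n.+1) : A \in unitmx -> count_scales A.
Proof.
move=> uA; have := cormen_lup_perm A; have := cormen_lup_correct A.
have := cormen_lup_detL A; have := @cormen_lup_lower _ _ A; have := @cormen_lup_upper _ _ A.
case: (cormen_lup A) => [[P L] U] /= Uu Ll dL PA /is_perm_mxP [s Ps].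
move: (PA : P *m A = L *m U) => {}PA.
have uL : L \in unitmx by rewrite unitmxE dL unitr1.
have uP : P \in unitmx by rewrite Ps unitmx_perm.
have uU : U \in unitmx.
  have : P *m A \in unitmx by rewrite unitmx_mul uP.
  by rewrite PA unitmx_mul uL.
have -> : A = perm_mx s^-1%g *m (L *m U).
  rewrite -PA Ps mulmxA.
  by rewrite -perm_mxM mulVg perm_mx1 mul1mx.
apply: count_scalesM (count_scales_perm _) _; first by rewrite unitmx_mul uL.
apply: count_scalesM => //.
  apply: count_scales_lower => [i j ij|i]; last by rewrite Ll ?eqxx ?oner_neq0.
  by rewrite Ll ?(ltnW ij)// -val_eqE /= ltn_eqF.
apply: count_scales_upper => [i j|i]; first exact: Uu.
have := uU; rewrite unitmxE -det_tr det_trig => [|]; last first.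
  by apply/is_trig_mxP => k l kl; rewrite mxE Uu.
by rewrite unitfE prodf_seq_neq0 => /allP /(_ i (mem_index_enum _)) /=; rewrite mxE.
Qed.

(** Coordinates are shifted one at a time, each by [column_count] with d = 1. The partly shifted
    sets stay in the cube, since each of their coordinates obeys the bound for K or the one for its
    full translate. *)
Lemma translate_count n N (K : set 'rV[R]_n.+1) (v : 'rV[R]_n.+1) :
  row_convex K -> in_box N%:R K -> in_box N%:R [set x | K (x + v)] ->
  `|lattice_count N [set x | K (x + v)] - lattice_count N K|
    <= n.+1%:R * (2 * ((2 * N).+1%:R) ^+ n).
Proof.
move=> cK bK bKv.
pose w m : 'rV[R]_n.+1 := \row_i (if (i < m)%N then v 0 i else 0).
have cKw m : row_convex [set x | K (x + w m)].
  move=> x y t /= Kx Ky /(cK _ _ _ Kx Ky); congr (K _).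
  by apply/rowP => i; rewrite !mxE; ring.
have bKw m : in_box N%:R [set x | K (x + w m)].
  move=> x /= Kx i; have [im|im] := boolP (i < m)%N.
    have := @bKv (x + w m - v); rewrite /= subrK => /(_ Kx i).
    by rewrite !mxE im addrK.
  by have := bK _ Kx i; rewrite !mxE (negPf im) addr0.
suff H m : (m <= n.+1)%N -> `|lattice_count N [set x | K (x + w m)] - lattice_count N K|
    <= m%:R * (2 * ((2 * N).+1%:R) ^+ n).
  have := H _ (leqnn _); congr (`|lattice_count N _ - _| <= _).
  apply/seteqP; split=> x /=; congr (K (_ + _)); apply/rowP => i; by rewrite mxE ltn_ord.
elim: m => [_|m IH mn].
  rewrite mul0r (_ : [set x | _] = K) ?subrr ?normr0//.
  by apply/seteqP; split=> x /=; congr (K _); apply/rowP => i; rewrite !mxE addr0.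
rewrite (le_trans (ler_distD (lattice_count N [set x | K (x + w m)]) _ _))//.
rewrite -natr1 mulrDl mul1r addrC lerD ?IH ?(ltnW mn)//.
pose j : 'I_n.+1 := Ordinal mn.
have := @column_count _ j N 1 (fun=> v 0 j) _ _ (cKw m) (oner_neq0 _) (bKw m) (bKw m.+1).
rewrite normr1 mul1r; apply=> // x /=; rewrite mul1r.
suff -> : x + w m.+1 = set_coord j (x 0 j + v 0 j) x + w m by [].
apply/rowP => i; rewrite !mxE; case: eqP => [->|/eqP/negPf ij].
  by rewrite /= ltnSn ltnn addr0.
by rewrite ltnS leq_eqVlt [_ == _ :> nat]ij.
Qed.

End LatticeCount.

(** * Counting with bounded positive and negative parts *)

(** Pascal's rule, in a form that serves both the recursion [legendre_sumS] and the Leibniz rule. *)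
Lemma pascal_sum (V : zmodType) n (f : nat -> nat -> V) :
  \sum_(k < n.+2) f k (n.+1 - k)%N *+ 'C(n.+1, k) =
  \sum_(k < n.+1) (f k (n.+1 - k)%N + f k.+1 (n - k)%N) *+ 'C(n, k).
Proof.
under [RHS]eq_bigr do rewrite mulrnDl.
rewrite big_split /= big_ord_recl /= bin0 subn0.
under eq_bigr do rewrite binS mulrnDr subSS.
rewrite big_split /= addrA; congr (_ + _).
transitivity (\sum_(k < n.+2) f k (n.+1 - k)%N *+ 'C(n, k)).
  by rewrite [RHS]big_ord_recl /= bin0 subn0.
by rewrite big_ord_recr /= bin_small// mulr0n addr0.
Qed.

Section PolytopeCount.
Variable R : realType.
Implicit Types (x y P Q : R) (p q : nat).

(** For x >= 0 this is the volume of the simplex of nonnegative vectors in dimension j with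
    coordinate sum at most x. *)
Definition pow_fact j x := x ^+ j / j`!%:R.

Lemma pow_fact_ge0 j x : 0 <= x -> 0 <= pow_fact j x.
Proof. by move=> x0; rewrite divr_ge0 ?exprn_ge0 ?ler0n. Qed.

Lemma ler_pow_fact j x y : 0 <= x -> x <= y -> pow_fact j x <= pow_fact j y.
Proof.
by move=> x0 xy; rewrite ler_wpM2r ?invr_ge0 ?ler0n// lerXn2r// nnegrE// (le_trans x0).
Qed.

(** The difference of the powers is a sum of j + 1 products, each between x^j and (x+1)^j. *)
Lemma pow_fact_incr j x : 0 <= x ->
  pow_fact j x <= pow_fact j.+1 (x + 1) - pow_fact j.+1 x <= pow_fact j (x + 1).
Proof.
move=> x0; have f0 : 0 < j.+1`!%:R :> R by rewrite ltr0n fact_gt0.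
rewrite /pow_fact -mulrBl subrXX addrAC subrr add0r mul1r.
have pfE (y : R) : y / j`!%:R = (y *+ j.+1) / j.+1`!%:R.
  have j0 : j.+1%:R != 0 :> R by rewrite pnatr_eq0.
  have fj0 : j`!%:R != 0 :> R by rewrite pnatr_eq0 -lt0n fact_gt0.
  by rewrite factS natrM invfM -[y *+ _]mulr_natr mulrA mulfK.
have sumE (y : R) : y *+ j.+1 = \sum_(i < j.+1) y by rewrite sumr_const card_ord.
rewrite (pfE (x ^+ j)) (pfE ((x + 1) ^+ j)) !ler_pM2r ?invr_gt0//; apply/andP; split.
  rewrite sumE; apply: ler_sum => i _.
  have -> : x ^+ j = x ^+ (j.+1.-1 - i + i) by rewrite subnK// -ltnS.
  rewrite exprD ler_wpM2r ?exprn_ge0//; apply: lerXn2r; rewrite ?nnegrE; lra.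
rewrite sumE; apply: ler_sum => i _.
have -> : (x + 1) ^+ j = (x + 1) ^+ (j.+1.-1 - i + i) by rewrite subnK// -ltnS.
rewrite exprD ler_wpM2l ?exprn_ge0//; first lra.
apply: lerXn2r; rewrite ?nnegrE; lra.
Qed.

(** A Riemann sum against the integral of [pow_fact j], telescoped through [pow_fact_incr]; the next
    lemma is the bound from the other side. *)
Lemma sum_pow_fact_le M p j x : 0 <= x ->
  \sum_(s < M | (s <= p)%N) pow_fact j ((p - s)%:R + x)
    <= pow_fact j.+1 (p.+1%:R + x) - pow_fact j.+1 ((p.+1 - M)%:R + x).
Proof.
move=> x0; elim: M => [|M IH]; first by rewrite big_ord0 subn0 subrr.
rewrite big_mkcond big_ord_recr /= -big_mkcond /=; case: leqP => pM; last first.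
  have [e1 e2] : (p.+1 - M = 0 /\ p.+1 - M.+1 = 0)%N by lia.
  by rewrite addr0 e2; move: IH; rewrite e1.
rewrite subSS -lerBrDr; apply: (le_trans IH).
have x1 : 0 <= (p - M)%:R + x by rewrite addr_ge0.
have /andP[] := pow_fact_incr j x1; rewrite (subSn pM) -[(p - M).+1%:R]natr1.
by rewrite [X in pow_fact j.+1 X - _]addrAC => h _; lra.
Qed.

Lemma sum_pow_fact_ge M p j :
  pow_fact j.+1 p%:R - pow_fact j.+1 (p - M)%:R
    <= \sum_(s < M | (s <= p)%N) pow_fact j (p - s)%:R.
Proof.
elim: M => [|M IH]; first by rewrite big_ord0 subn0 subrr.
rewrite big_mkcond big_ord_recr /= -big_mkcond /=; case: leqP => pM; last first.
  have [e1 e2] : (p - M = 0 /\ p - M.+1 = 0)%N by lia.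
  by rewrite addr0 e2; move: IH; rewrite e1.
rewrite -lerBlDr; apply: le_trans IH.
have [pM'|pM'] := ltnP M p; last first.
  rewrite (_ : p - M = 0)%N; last by apply/eqP; rewrite subn_eq0.
  rewrite (_ : p - M.+1 = 0)%N; last by apply/eqP; rewrite subn_eq0 ltnW.
  by rewrite lerBlDr lerDl pow_fact_ge0.
have /andP[_] := pow_fact_incr j (ler0n R (p - M.+1)).
by rewrite natr1 subnSK// => h; lra.
Qed.

(** For P, Q >= 0, the volume of the set of vectors in dimension n whose positive parts add up to at
    most P and negative parts to at most Q; k is the number of negative coordinates. *)
Definition legendre_sum n P Q :=
  \sum_(k < n.+1) 'C(n, k)%:R * pow_fact k Q * pow_fact (n - k) P.

Lemma legendre_sumS n P Q : legendre_sum n.+1 P Q =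
  \sum_(k < n.+1) 'C(n, k)%:R * (pow_fact k Q * pow_fact (n.+1 - k) P
     + pow_fact k.+1 Q * pow_fact (n - k) P).
Proof.
under [RHS]eq_bigr do rewrite mulr_natl.
rewrite -(pascal_sum n (fun k l => pow_fact k Q * pow_fact l P)).
by apply: eq_bigr => k _; rewrite -mulrA mulr_natl.
Qed.

(** The truncated subtractions k i - N and N - k i are the positive and negative parts of the i-th
    coordinate. *)
Definition orth_count n N p q : R :=
  \sum_(k : {ffun 'I_n -> 'I_(2 * N).+1})
    ((\sum_i (k i - N) <= p)%N && (\sum_i (N - k i) <= q)%N : nat)%:R.

(** The first coordinate is either s >= 0 and uses up s of p, or -(s + 1) and uses up s + 1 of q. *)
Lemma orth_countS n N p q : orth_count n.+1 N p q =
  \sum_(s < N.+1 | (s <= p)%N) orth_count n N (p - s) q +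
  \sum_(s < N | (s.+1 <= q)%N) orth_count n N p (q - s.+1).
Proof.
rewrite /orth_count (sum_ffun_insert ord0) exchange_big /=.
pose f a b := \sum_(k : {ffun 'I_n -> 'I_(2 * N).+1})
  ((a + \sum_i (k i - N) <= p)%N && (b + \sum_i (N - k i) <= q)%N : nat)%:R : R.
transitivity (\sum_(t < (2 * N).+1) f (t - N)%N (N - t)%N).
  apply: eq_bigr => t _; apply: eq_bigr => k _; rewrite !big_ord_recl !ffunE unlift_none /=.
  congr ((nat_of_bool (_ && _))%:R); congr (_ + _ <= _)%N;
    by apply: eq_bigr => i _; rewrite ffunE liftK.
have fE a b : f a b = if (a <= p)%N && (b <= q)%N then orth_count n N (p - a) (q - b) else 0.
  case: ifP => [/andP[ap bq]|ab].
    by apply: eq_bigr => k _; rewrite !leq_subRL.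
  apply: big1 => k _; rewrite (_ : _ && _ = false)//; apply/negP => /andP[h1 h2].
  by move/negP: ab; apply; rewrite (leq_trans (leq_addr _ _) h1) (leq_trans (leq_addr _ _) h2).
rewrite -(big_mkord xpredT (fun t => f (t - N)%N (N - t)%N)).
rewrite (@big_cat_nat _ _ _ N) //=; last by lia.
rewrite addrC; congr (_ + _).
  rewrite -{1}[N]add0n big_addn big_mkord [RHS]big_mkcond /=.
  rewrite (_ : (2 * N).+1 - N = N.+1)%N; last by lia.
  apply: eq_bigr => s _; rewrite addnK fE (_ : N - (s + N) = 0)%N; last by lia.
  by rewrite andbT subn0.
rewrite big_nat_rev add0n big_mkord [RHS]big_mkcond /=.
apply: eq_bigr => s _; rewrite fE.
have [-> ->] : (N - s.+1 - N = 0 /\ N - (N - s.+1) = s.+1)%N.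
  by move: (nat_of_ord s) (ltn_ord s) => t; lia.
by rewrite leq0n subn0.
Qed.

(** Every coordinate costs one Riemann sum that overshoots its integral by a shift of 1, hence the
    shift n after n coordinates. *)
Lemma orth_count_le n N p q :
  orth_count n N p q <= legendre_sum n (p%:R + n%:R) (q%:R + n%:R).
Proof.
elim: n p q => [|n IH] p q.
  rewrite /orth_count /legendre_sum big_ord_recl big_ord0 addr0.
  rewrite /pow_fact !expr0 fact0 invr1 !mulr1 (eq_bigr (fun=> 1)).
    by rewrite sumr_const card_ffun !card_ord expn0.
  by move=> k _; rewrite !big_ord0.
rewrite orth_countS legendre_sumS.
under [leRHS]eq_bigr do rewrite mulrDr.
rewrite big_split /= lerD//.
  apply: (le_trans (ler_sum _ (fun s _ => IH _ _))).
  rewrite exchange_big /=; apply: ler_sum => k _.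
  under eq_bigr do rewrite -mulrA.
  rewrite -!mulr_sumr ler_wpM2l ?ler0n// ler_pM ?pow_fact_ge0 ?sumr_ge0//.
  - by move=> s _; rewrite pow_fact_ge0// addr_ge0.
  - by rewrite ler_pow_fact ?addr_ge0// -natr1; lra.
  apply: (le_trans (@sum_pow_fact_le _ _ _ n%:R (ler0n _ _))).
  rewrite (subSn (leq_ord k)).
  rewrite (_ : p.+1%:R + n%:R = p%:R + n.+1%:R); last by rewrite -!natr1; ring.
  by rewrite lerBlDr lerDl pow_fact_ge0// addr_ge0.
apply: (le_trans (ler_sum _ (fun s _ => IH _ _))).
rewrite exchange_big /=; apply: ler_sum => k _.
under eq_bigr do rewrite -mulrA.
rewrite -!mulr_sumr ler_wpM2l ?ler0n// -mulr_suml ler_pM ?pow_fact_ge0 ?sumr_ge0//.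
- by move=> s _; rewrite pow_fact_ge0// addr_ge0.
- case: q => [|q]; first by rewrite big_pred0 ?pow_fact_ge0// addr_ge0.
  under eq_bigl do rewrite ltnS.
  under eq_bigr do rewrite subSS.
  apply: (le_trans (@sum_pow_fact_le _ _ _ n%:R (ler0n _ _))).
  apply: (@le_trans _ _ (pow_fact k.+1 (q.+1%:R + n%:R))).
    by rewrite lerBlDr lerDl pow_fact_ge0// addr_ge0.
  by rewrite ler_pow_fact ?addr_ge0// -[n.+1%:R]natr1; lra.
by rewrite ler_pow_fact ?addr_ge0// -[n.+1%:R]natr1; lra.
Qed.

(** The lower bound serves the simplex, where negative parts vanish; p <= N keeps its lattice points
    inside the cube. *)
Lemma orth_count_ge n N p : (p <= N)%N -> pow_fact n p%:R <= orth_count n N p 0.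
Proof.
elim: n p => [|n IH] p pN.
  rewrite /pow_fact expr0 fact0 invr1 mulr1 /orth_count (eq_bigr (fun=> 1)).
    by rewrite sumr_const card_ffun !card_ord expn0.
  by move=> k _; rewrite !big_ord0.
rewrite orth_countS [X in _ + X]big_pred0// addr0.
have := sum_pow_fact_ge N.+1 p n.
rewrite (_ : p - N.+1 = 0)%N; last by apply/eqP; rewrite subn_eq0 (leq_trans pN).
rewrite [pow_fact _ 0]/pow_fact expr0n mul0r subr0 => /le_trans; apply.
by apply: ler_sum => s sp; apply: IH; apply: leq_trans pN; rewrite leq_subr.
Qed.

End PolytopeCount.

(** * Legendre polynomials *)

Lemma derivn_mul (R : comNzRingType) n (p q : {poly R}) :
  (p * q)^`(n) = \sum_(k < n.+1) (p^`(k) * q^`(n - k)) *+ 'C(n, k).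
Proof.
elim: n => [|n IH]; first by rewrite big_ord_recl big_ord0 addr0 !derivn0.
rewrite derivnS IH (pascal_sum _ (fun k l => p^`(k) * q^`(l))) raddf_sum.
apply: eq_bigr => k _; rewrite /= derivMn derivM addrC -!derivnS subSn //.
by rewrite -ltnS.
Qed.

Lemma derivn_XsubC_exp (R : comNzRingType) (a : R) n k :
  (('X - a%:P) ^+ n)^`(k) = ('X - a%:P) ^+ (n - k) *+ n ^_ k.
Proof.
elim: k => [|k IH]; first by rewrite subn0.
rewrite derivnS IH derivMn deriv_exp derivXsubC mul1r -mulrnA -subnS.
by rewrite ffactnSr mulnC.
Qed.

Section LegendreValue.
Variable R : realType.

(** The Leibniz rule is applied to (t + 1)^n (t - 1)^n. At t = 1 + 2s the factors are 2(1 + s) and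
    2s, and their powers of 2 cancel the 2^n of Rodrigues' formula. *)
Lemma chi_legendre_sum n (s : R) :
  (chi R n).[1 + 2 * s] = n`!%:R * legendre_sum n (1 + s) s.
Proof.
have fact0 m : m`!%:R != 0 :> R by rewrite pnatr_eq0 -lt0n fact_gt0.
rewrite /chi; have -> : 'X ^+ 2 - 1 = ('X - (-1)%:P) * ('X - 1%:P) :> {poly R}.
  by rewrite polyCN polyC1; ring.
rewrite exprMn derivn_mul hornerZ horner_sum /legendre_sum !mulr_sumr.
apply: eq_bigr => k _; have kn : (k <= n)%N by rewrite -ltnS.
rewrite !derivn_XsubC_exp subKn// hornerMn hornerM !hornerMn !horner_exp !hornerXsubC.
rewrite (_ : 1 + 2 * s - -1 = 2 * (1 + s)); last by ring.
rewrite (_ : 1 + 2 * s - 1 = 2 * s); last by ring.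
rewrite -[X in (X ^+ n * _)^-1]/2 !exprMn /pow_fact.
have e1 : (n ^_ k)%:R * (n - k)`!%:R = n`!%:R :> R by rewrite -natrM ffact_fact.
have e2 : (n ^_ (n - k))%:R * k`!%:R = n`!%:R :> R.
  by rewrite -{2}(subKn kn) -natrM ffact_fact// leq_subr.
have e3 : 2 ^+ n = 2 ^+ k * 2 ^+ (n - k) :> R by rewrite -exprD subnKC.
have : 2 ^+ n != 0 :> R by rewrite expf_neq0// pnatr_eq0.
have := fact0 n; have := fact0 k; have := fact0 (n - k)%N.
rewrite -[_ *+ n ^_ k]mulr_natr -[_ *+ n ^_ (n - k)]mulr_natr -[_ *+ 'C(n, k)]mulr_natr.
move: e1 e2 e3.
move: ((n ^_ k)%:R : R) ((n ^_ (n - k))%:R : R) => u v.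
move: (n`!%:R : R) (k`!%:R : R) ((n - k)`!%:R : R) => a b c.
move: ((1 + s) ^+ _) (s ^+ _) (2 ^+ _ : R) (2 ^+ k : R) (2 ^+ (n - k) : R) => x y z z1 z2.
move=> e1 e2 e3 c0 b0 a0 z0.
have -> : a * ('C(n, k)%:R * (y / b) * (x / c)) =
  (u * c) * (v * b) / a * ('C(n, k)%:R * (y / b) * (x / c)) by rewrite e1 e2 mulfK.
rewrite e3 mulf_eq0 negb_or in z0; case/andP: z0 => z1n z2n; rewrite e3.
by field; rewrite z1n z2n c0 b0 a0.
Qed.

Lemma legendre_sum_le n (p q P Q : R) : 0 <= p -> 0 <= q -> p <= P -> q <= Q ->
  legendre_sum n p q <= legendre_sum n P Q.
Proof.
move=> p0 q0 pP qQ; apply: ler_sum => k _.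
apply: ler_pM; [by rewrite mulr_ge0 ?pow_fact_ge0|exact: pow_fact_ge0
    |by rewrite ler_wpM2l ?ler_pow_fact|exact: ler_pow_fact].
Qed.

Lemma legendre_sum_lt n (s t : R) : (0 < n)%N -> 0 <= s -> s < t ->
  legendre_sum n (1 + s) s < legendre_sum n (1 + t) t.
Proof.
(* Strictness comes from the term k = 0, which is (1 + s)^n / n!. *)
move=> n0 s0 st; rewrite /legendre_sum !big_ord_recl ltr_leD//; last first.
  apply: ler_sum => k _; have [s1 [st' st1]] : 0 <= 1 + s /\ s <= t /\ 1 + s <= 1 + t by lra.
  apply: ler_pM; [by rewrite mulr_ge0 ?pow_fact_ge0|exact: pow_fact_ge0
    |by rewrite ler_wpM2l ?ler_pow_fact|exact: ler_pow_fact].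
rewrite bin0 /pow_fact !expr0 fact0 invr1 !mul1r subn0.
rewrite ltr_pM2r ?invr_gt0 ?ltr0n ?fact_gt0// ltrXn2r -?lt0n//; lra.
Qed.

Lemma chi_lt n (t u : R) : (0 < n)%N -> 1 <= t -> t < u -> (chi R n).[t] < (chi R n).[u].
Proof.
move=> n0 t1 tu.
have E v : v = 1 + 2 * ((v - 1) / 2) :> R by field.
rewrite (E t) (E u) !chi_legendre_sum ltr_pM2l ?ltr0n ?fact_gt0//.
by apply: legendre_sum_lt => //; lra.
Qed.

End LegendreValue.

(** * Lattice counts of affine images and of the model body *)

Section AffineCount.
Variable R : realType.

(* K' is the image of K under mu |-> mu D + m v. *)
Lemma affine_count n (D : 'M[R]_n.+1) (v : 'rV[R]_n.+1) (g : R) :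
  D \in unitmx -> 0 <= g -> exists (C : R) (c : nat), (0 < c)%N /\
  forall (m : nat) (K : set 'rV[R]_n.+1), (0 < m)%N -> row_convex K -> in_box (g * m%:R) K ->
    let K' := [set z | K ((z - m%:R *: v) *m invmx D)] in
    in_box (c * m)%:R K' /\
    `|lattice_count (c * m) K' - `|\det D| * lattice_count (c * m) K| <= C * m%:R ^+ n.
Proof.
move=> uD g0; have uI : invmx D \in unitmx by rewrite unitmx_inv.
have [C0 [b hC]] := count_scales_unitmx uI.
pose e := entry_sum D * g; have e0 : 0 <= e by rewrite mulr_ge0 ?entry_sum_ge0.
pose V := entry_sum v; have V0 : 0 <= V by apply: entry_sum_ge0.
(* The three summands meet the size condition of [count_scales], the box of the linear image and the
   length of the translation. *)
pose B := `|b| * g + e + V; have B0 : 0 <= B by rewrite addr_ge0 // addr_ge0 // mulr_ge0.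
pose c := (Num.truncn B).+1; have cB : B <= c%:R by apply/ltW/truncnS_gt.
have bB : `|b| * g <= c%:R by apply: le_trans cB; rewrite /B -addrA lerDl addr_ge0.
(* The two terms come from the translation and from the linear map; 3 c arises from 2 c m + 1 <= 3 c
   m. *)
exists ((n.+1%:R * 2 + `|\det D| * `|C0|) * (3 * c)%:R ^+ n), c; split=> // m K m0 cK bK K'.
have mR : 0 <= m%:R :> R by apply: ler0n.
pose K1 := [set x | K (x *m invmx D)].
have bK1 : in_box (e * m%:R) K1.
  have := in_box_preim uI (mulr_ge0 g0 mR) bK; rewrite invmxK mulrA; exact: in_box_le.
have boundc r : r <= B -> r * m%:R <= (c * m)%:R.
  by move=> rB; rewrite natrM ler_wpM2r// (le_trans rB).
have bK1c : in_box (c * m)%:R K1.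
  by apply: in_box_le bK1; apply: boundc; rewrite /B [_ + e]addrC -addrA lerDl addr_ge0 ?mulr_ge0.
have bK' : in_box (c * m)%:R K'.
  apply: (@in_box_le _ _ _ ((e + V) * m%:R)) => [|z /bK1 zb i].
    by apply: boundc; rewrite /B -addrA lerDr mulr_ge0.
  have -> : z 0 i = (z - m%:R *: v) 0 i + m%:R * v 0 i by rewrite !mxE subrK.
  rewrite (le_trans (ler_normD _ _))// mulrDl lerD// normrM ger0_norm// mulrC ler_wpM2r//.
  rewrite /V /entry_sum big_ord_recl big_ord0 addr0 (bigD1 i)//= lerDl sumr_ge0//.
split=> //.
have H1 : `|lattice_count (c * m) K' - lattice_count (c * m) K1|
    <= n.+1%:R * (2 * ((2 * (c * m)).+1%:R) ^+ n).
  have := @translate_count R n (c * m) K1 (- (m%:R *: v)).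
  apply=> //; exact: row_convex_preim.
have H2 := hC _ (c * m)%N _ (mulr_ge0 g0 mR) cK bK _.
have {}H2 : `|lattice_count (c * m) K1 - `|\det D| * lattice_count (c * m) K|
    <= `|\det D| * `|C0| * ((2 * (c * m)).+1%:R) ^+ n.
  have d0 : `|\det D| != 0 by rewrite normr_eq0 -unitfE -unitmxE.
  have -> : lattice_count (c * m) K1 - `|\det D| * lattice_count (c * m) K =
     `|\det D| * (`|\det (invmx D)| * lattice_count (c * m) K1 - lattice_count (c * m) K).
    by rewrite det_inv normfV mulrBr mulrA mulfV// mul1r.
  rewrite normrM normr_id -mulrA ler_wpM2l//; apply: le_trans (H2 _) _.
    apply: le_trans (ler_norm _) _; rewrite normrM normrM (ger0_norm g0) (ger0_norm mR) mulrA.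
    by rewrite natrM ler_wpM2r.
  by rewrite ler_wpM2r ?exprn_ge0// ler_norm.
apply: (le_trans (ler_distD (lattice_count (c * m) K1) _ _)).
apply: (le_trans (lerD H1 H2)).
rewrite mulrA -mulrDl -mulrA -exprMn ler_wpM2l ?addr_ge0 ?mulr_ge0//.
rewrite lerXn2r ?nnegrE ?mulr_ge0// -natrM ler_nat.
have : (0 < c * m)%N by rewrite muln_gt0 m0.
by rewrite -mulnA; move: (c * m)%N => k; lia.
Qed.

(** The entries of u and m - sum u are m times the barycentric coordinates of a point, so for m > 0
    this is the m-fold dilate of E_g in coordinates. *)
Definition abs_body n (g m : R) : set 'rV[R]_n :=
  [set u | \sum_i `|u 0 i| + `|m - \sum_i u 0 i| <= g * m].

Lemma abs_body_convex n g m : row_convex (@abs_body n g m).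
Proof.
move=> x y t /= Kx Ky /andP[t0 t1]; rewrite -subr_ge0 in t1.
rewrite /abs_body /=; apply: (@le_trans _ _ (t * (g * m) + (1 - t) * (g * m))); last lra.
apply: (le_trans _ (lerD (ler_wpM2l t0 Kx) (ler_wpM2l t1 Ky))).
rewrite !mulrDr addrACA !mulr_sumr -big_split /= lerD//.
  apply: ler_sum => i _; rewrite !mxE (le_trans (ler_normD _ _))//.
  by rewrite !normrM (ger0_norm t0) (ger0_norm t1).
under eq_bigr do rewrite !mxE.
rewrite big_split /= -!mulr_sumr.
move: (\sum_i x 0 i) (\sum_i y 0 i) => a b.
have -> : m - (t * a + (1 - t) * b) = t * (m - a) + (1 - t) * (m - b) by ring.
by rewrite (le_trans (ler_normD _ _))// !normrM (ger0_norm t0) (ger0_norm t1).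
Qed.

Lemma in_box_abs_body n g m : in_box (g * m) (@abs_body n g m).
Proof.
move=> x Kx i; apply: le_trans Kx; rewrite (bigD1 i)//= -addrA lerDl.
by rewrite addr_ge0// sumr_ge0.
Qed.

(** With p and q the sums of positive and negative parts, the condition reads p + q + |m - p + q| <=
    (1 + 2s) m. The two signs of the absolute value give q <= s m and p <= (1 + s) m, and each
    implies the other bound in its case. *)
Lemma abs_body_lattice n N (k : {ffun 'I_n -> 'I_(2 * N).+1}) (s m : R) :
  abs_body (1 + 2 * s) m (lattice_pt R k) <->
  (\sum_i (k i - N)%N)%:R <= (1 + s) * m /\ (\sum_i (N - k i)%N)%:R <= s * m.
Proof.
rewrite /abs_body /=.
have -> : \sum_i `|(lattice_pt R k) 0 i| = (\sum_i (k i - N)%N)%:R + (\sum_i (N - k i)%N)%:R.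
  rewrite !natr_sum -big_split; apply: eq_bigr => i _; rewrite mxE /=.
  case: (leqP N (k i)) => kN.
    rewrite (_ : N - k i = 0)%N ?addr0; last by apply/eqP; rewrite subn_eq0.
    by rewrite natrB// ger0_norm// subr_ge0 ler_nat.
  rewrite (_ : k i - N = 0)%N ?add0r; last by apply/eqP; rewrite subn_eq0 ltnW.
  by rewrite natrB 1?ltnW// ler0_norm ?opprB// subr_le0 ler_nat ltnW.
have -> : \sum_i (lattice_pt R k) 0 i = (\sum_i (k i - N)%N)%:R - (\sum_i (N - k i)%N)%:R.
  rewrite !natr_sum -sumrB; apply: eq_bigr => i _; rewrite mxE /=.
  case: (leqP N (k i)) => kN.
    by rewrite (_ : N - k i = 0)%N ?subr0 ?natrB//; apply/eqP; rewrite subn_eq0.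
  rewrite (_ : k i - N = 0)%N; last by apply/eqP; rewrite subn_eq0 ltnW.
  by rewrite natrB 1?ltnW// sub0r opprB.
move: (_%:R) (_%:R) => p q.
split=> [|[h1 h2]].
  by case: ler0P => h1 h2; split; lra.
by case: ler0P => h; lra.
Qed.

Lemma lattice_count_abs_body_le n N (s : R) (m : nat) : 0 <= s -> (0 < m)%N ->
  lattice_count N (@abs_body n (1 + 2 * s) m%:R)
    <= m%:R ^+ n * legendre_sum n (1 + s + n%:R / m%:R) (s + n%:R / m%:R).
Proof.
move=> s0 m0; have mR : 0 < m%:R :> R by rewrite ltr0n.
pose p := Num.truncn ((1 + s) * m%:R); pose q := Num.truncn (s * m%:R).
have p0 : 0 <= (1 + s) * m%:R by rewrite mulr_ge0 ?addr_ge0.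
have q0 : 0 <= s * m%:R by rewrite mulr_ge0.
apply: (@le_trans _ _ (orth_count R n N p q)).
  apply: ler_sum => k _; rewrite ler_nat; case: asboolP => // /abs_body_lattice[h1 h2].
  by rewrite !truncn_ge_nat// h1 h2.
apply: (le_trans (orth_count_le _ _ _ _ _)).
apply: (@le_trans _ _ (legendre_sum n (m%:R * (1 + s + n%:R / m%:R)) (m%:R * (s + n%:R / m%:R)))).
  have e : m%:R * (n%:R / m%:R) = n%:R :> R by rewrite mulrC divfK// gt_eqF.
  by apply: legendre_sum_le; rewrite ?addr_ge0// mulrDr e lerD2r mulrC truncn_le.
(* [legendre_sum] is homogeneous of degree n. *)
rewrite le_eqVlt; apply/orP; left; apply/eqP.
rewrite /legendre_sum mulr_sumr; apply: eq_bigr => k _.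
have -> : m%:R ^+ n = m%:R ^+ k * m%:R ^+ (n - k) :> R by rewrite -exprD subnKC// -ltnS.
rewrite /pow_fact !exprMn; ring.
Qed.

Lemma lattice_count_abs_body_ge n N (m : nat) : (m <= N)%N ->
  m%:R ^+ n / n`!%:R <= lattice_count N (@abs_body n 1 (m%:R : R)).
Proof.
move=> mN; apply: (le_trans (orth_count_ge R n mN)).
apply: ler_sum => k _; rewrite ler_nat.
case h : (_ && _) => //; rewrite asboolT//.
suff: abs_body (1 + 2 * 0) m%:R (lattice_pt R k) by rewrite mulr0 addr0.
apply/abs_body_lattice; move/andP: h => [h1 h2].
by rewrite addr0 mul1r mul0r ler_nat lern0 -leqn0.
Qed.

End AffineCount.

(** * Barycentric bodies and their volumes *)

Section SimplexVolume.
Variable R : realType.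

Definition edge_mx n (x : 'I_n.+1 -> 'rV[R]_n) : 'M[R]_n :=
  \matrix_(i < n) (x (lift ord_max i) - x ord_max).

Lemma sum_lift_max n (V : nmodType) (F : 'I_n.+1 -> V) :
  \sum_j F j = \sum_(i < n) F (lift ord_max i) + F ord_max.
Proof.
rewrite big_ord_recr /=; congr (_ + _); apply: eq_bigr => i _; congr F.
by apply: val_inj; rewrite [RHS]lift_max.
Qed.

Lemma vertex_matrix_max n (x : 'I_n.+1 -> 'rV[R]_n) j : vertex_matrix x j ord_max = 1.
Proof. by rewrite !mxE unlift_none. Qed.

Lemma vertex_matrix_lift n (x : 'I_n.+1 -> 'rV[R]_n) j i :
  vertex_matrix x j (lift ord_max i) = x j 0 i.
Proof. by rewrite !mxE liftK. Qed.

Lemma det_edge_mx n (x : 'I_n.+1 -> 'rV[R]_n) :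
  \det (edge_mx x) = \det (vertex_matrix x).
Proof.
(* E subtracts the last row from all others; the last column then becomes a unit vector, along which
   the determinant is expanded. *)
pose E : 'M[R]_n.+1 :=
  \matrix_(i, j) ((i == j)%:R - ((j == ord_max) && (i != ord_max))%:R).
have dE : \det E = 1.
  rewrite -det_tr det_trig.
    rewrite big1// => i _; rewrite !mxE eqxx; case: eqP => //= _; by rewrite subr0.
  apply/is_trig_mxP => i j ij.
  have ji : (j == i) = false by rewrite -val_eqE /= gtn_eqF.
  have im : (i == ord_max) = false.
    by rewrite -val_eqE /= ltn_eqF// (leq_trans ij)// -ltnS.
  by rewrite !mxE ji im subr0.
rewrite -[RHS]mul1r -dE -det_mulmx.
set B := E *m _.
have BE i j : B i j = vertex_matrix x i j - (i != ord_max)%:R * vertex_matrix x ord_max j.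
  rewrite mxE; under eq_bigr do rewrite mxE mulrBl.
  rewrite sumrB; congr (_ - _).
    rewrite (bigD1 i)//= eqxx mul1r big1 ?addr0// => k /negPf ki.
    by rewrite eq_sym ki mul0r.
  by rewrite (bigD1 ord_max)//= eqxx big1 ?addr0// => k /negPf ->; rewrite mul0r.
rewrite (expand_det_col B ord_max) sum_lift_max big1 ?add0r; last first.
  by move=> i _; rewrite BE !vertex_matrix_max eq_sym neq_lift mulr1 subrr mul0r.
rewrite BE eqxx mul0r subr0 vertex_matrix_max mul1r /cofactor -signr_odd oddD addbb mul1r.
congr (\det _); apply/matrixP => i j; rewrite [RHS]mxE [RHS]mxE BE.
rewrite !vertex_matrix_lift eq_sym neq_lift mul1r.
by rewrite !mxE.
Qed.

Definition bary_body n (x : 'I_n.+1 -> 'rV[R]_n) (g : R) : set 'rV[R]_n :=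
  [set y | exists l : 'I_n.+1 -> R,
     [/\ \sum_j `|l j| <= g, \sum_j l j = 1 & y = \sum_j l j *: x j]].

Lemma simplex_hull_bary n (x : 'I_n.+1 -> 'rV[R]_n) : simplex_hull x = bary_body x 1.
Proof.
apply/seteqP; split=> y /= [l [l0 l1 ->]]; exists l; split=> //.
  by under eq_bigr do rewrite ger0_norm//; rewrite l1.
move=> j.
(* The terms are nonnegative and their sum is at most 1 - 1, so each |l j| equals l j. *)
have h : \sum_j (`|l j| - l j) = 0.
  apply/le_anti; rewrite sumrB l1 subr_le0 l0 -l1 -sumrB sumr_ge0// => i _.
  by rewrite subr_ge0 ler_norm.
have := @psumr_eq0P R _ xpredT (fun j => `|l j| - l j).
move=> /(_ _ h j isT) /=.
have h2 : forall i, true -> 0 <= `|l i| - l i by move=> i _; rewrite subr_ge0 ler_norm.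
by move=> /(_ h2) /eqP; rewrite subr_eq0 => /eqP <-.
Qed.

(** In the basis of edges issuing from the last vertex, z - m x_last has as coordinates m times the
    other barycentric coordinates of z / m. *)
Lemma dilated_bary_body n (x : 'I_n.+1 -> 'rV[R]_n) g m :
  edge_mx x \in unitmx -> 0 < m ->
  [set z | bary_body x g (m^-1 *: z)] =
  [set z | abs_body g m ((z - m *: x ord_max) *m invmx (edge_mx x))].
Proof.
move=> uD m0; have mn0 := lt0r_neq0 m0.
have combE (l : 'I_n.+1 -> R) : \sum_j l j = 1 ->
    m *: (\sum_j l j *: x j) - m *: x ord_max =
    (\row_i (m * l (lift ord_max i))) *m edge_mx x.
  move=> l1; rewrite -scalerBr -[x ord_max in LHS]scale1r -l1 scaler_suml -sumrB.
  rewrite sum_lift_max subrr addr0 scaler_sumr mulmx_sum_row.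
  by apply: eq_bigr => i _; rewrite rowK mxE -scalerBr scalerA.
apply/seteqP; split=> z /=.
  case=> l [lg l1 zE].
  have -> : z = m *: (\sum_j l j *: x j) by rewrite -zE scalerA mulfV// scale1r.
  rewrite combE// mulmxK// /abs_body /=.
  under eq_bigr do rewrite mxE normrM (gtr0_norm m0).
  under [X in _ - X]eq_bigr do rewrite mxE.
  rewrite -!mulr_sumr -{2}[m]mulr1 -mulrBr normrM (gtr0_norm m0) -mulrDr mulrC ler_pM2r//.
  move: lg; rewrite sum_lift_max; congr (_ + `|_| <= _).
  by move: l1; rewrite sum_lift_max => <-; ring.
set u := _ *m _ => /=; rewrite /abs_body /= => ug.
pose l j := if unlift ord_max j is Some i then u 0 i / m else 1 - (\sum_i u 0 i) / m.
have l1 : \sum_j l j = 1.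
  rewrite sum_lift_max {2}/l unlift_none mulr_suml.
  by under eq_bigr do rewrite /l liftK; rewrite addrC subrK.
have lg : \sum_j `|l j| <= g.
  rewrite sum_lift_max {2}/l unlift_none.
  under eq_bigr do rewrite /l liftK normrM normfV (gtr0_norm m0).
  rewrite -mulr_suml (_ : 1 - _ = (m - \sum_i u 0 i) / m); last by rewrite mulrBl divff.
  by rewrite normrM normfV (gtr0_norm m0) -mulrDl ler_pdivrMr.
exists l; split=> //; apply: (scalerI mn0).
rewrite scalerA mulfV// scale1r; apply: (addIr (- (m *: x ord_max))); rewrite combE//.
rewrite -[LHS](mulmxKV uD) -/u; congr (_ *m _); apply/rowP => i.
by rewrite [RHS]mxE /l liftK mulrC divfK.
Qed.

End SimplexVolume.

(** * Volumes as limits of lattice counts *)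

Section Volumes.
Variable R : realType.

(** This reconciles the cube of radius m in the definition of [vol] with the cube of radius c m in
    [affine_count]. *)
Lemma lattice_count_widen n M N (K : set 'rV[R]_n) :
  (M <= N)%N -> in_box M%:R K -> lattice_count N K = lattice_count M K.
Proof.
move=> MN bK; pose TM := {ffun 'I_n -> 'I_(2 * M).+1}; pose TN := {ffun 'I_n -> 'I_(2 * N).+1}.
have lt_shift (i : 'I_(2 * M).+1) : (i + (N - M) < (2 * N).+1)%N.
  by move: (ltn_ord i); move: (nat_of_ord i) => k; lia.
pose f (k : TM) : TN := [ffun i => Ordinal (lt_shift (k i))].
have f_inj : injective f.
  move=> k l /ffunP kl; apply/ffunP => i; have := kl i; rewrite !ffunE => /(congr1 val) /=.
  by move=> /addIn h; apply: val_inj.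
have fE k : lattice_pt R (f k) = lattice_pt R k.
  by apply/rowP => i; rewrite !mxE ffunE /= natrD natrB//; ring.
rewrite /lattice_count (bigID (mem (f @: [set: TM]%SET))) /= addrC big1 ?add0r.
  rewrite big_imset /=; last by move=> k l _ _; apply: f_inj.
  rewrite (eq_bigl xpredT) => [|k]; last by rewrite finset.in_setT.
  by apply: eq_bigr => k _; rewrite fE.
move=> k kf; rewrite asboolF// => /bK Kk; move/negP: kf; apply; apply/imsetP.
have kb i : (N - M <= k i <= N + M)%N.
  have := Kk i; rewrite mxE ler_norml lerBrDr lerBlDr [- _ + _]addrC -natrB// -natrD !ler_nat.
  by rewrite addnC.
have lt_back i : (k i - (N - M) < (2 * M).+1)%N.
  by move: (kb i); move: (nat_of_ord (k i)) => a; lia.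
exists [ffun i => Ordinal (lt_back i)]; first by rewrite finset.in_setT.
apply/ffunP => i; rewrite !ffunE; apply: val_inj; rewrite /= subnK//.
by case/andP: (kb i).
Qed.

Lemma grid_count_lattice n (K : set 'rV[R]_n) m :
  (grid_count K m)%:R = lattice_count m [set z | K (m%:R^-1 *: z)].
Proof.
rewrite /grid_count -sum1_card natr_sum big_mkcond /=; apply: eq_bigr => k _ /=.
have <- : grid_pt R k = m%:R^-1 *: lattice_pt R k.
  by apply/rowP => i; rewrite !mxE mulrC.
rewrite (_ : (k \in _) = `[<K (grid_pt R k)>]); first by case: asboolP.
exact: asboolb.
Qed.

(** The error C / m comes from the affine map, and the shift 2(n+1)/m in the argument of chi from
    the shift n + 1 in [orth_count_le]. The lower bound at g = 1 is for the volume of the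
    simplex. *)
Lemma bary_body_count n (x : 'I_n.+2 -> 'rV[R]_n.+1) (g : R) :
  \det (vertex_matrix x) != 0 -> 1 <= g ->
  exists (C : R) (c : nat), (0 < c)%N /\ forall m : nat, (0 < m)%N ->
    let K := [set z | bary_body x g (m%:R^-1 *: z)] in
    [/\ in_box (c * m)%:R K,
        lattice_count (c * m) K / m%:R ^+ n.+1 <= `|\det (vertex_matrix x)| *
          ((chi R n.+1).[g + 2 * n.+1%:R * m%:R^-1] / (n.+1)`!%:R) + C * m%:R^-1 &
        g = 1 -> `|\det (vertex_matrix x)| / (n.+1)`!%:R - C * m%:R^-1
          <= lattice_count (c * m) K / m%:R ^+ n.+1].
Proof.
rewrite -det_edge_mx => d0 g1.
have uD : edge_mx x \in unitmx by rewrite unitmxE unitfE.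
have g0 : 0 <= g by rewrite (le_trans ler01).
have [C [c [c0 hC]]] := affine_count (x ord_max) uD g0.
exists C, c; split=> // m m0 K; have mR : 0 < m%:R :> R by rewrite ltr0n.
have mX : 0 < m%:R ^+ n.+1 :> R by rewrite exprn_gt0.
rewrite /K (dilated_bary_body g uD mR).
have [bK' {hC}] := hC m _ m0 (@abs_body_convex R n.+1 g m%:R) (@in_box_abs_body R n.+1 g m%:R).
set a := lattice_count _ _; set b := lattice_count _ _.
rewrite ler_norml => /andP[ab1 ab2].
have CE : C * m%:R^-1 = C * m%:R ^+ n / m%:R ^+ n.+1.
  by rewrite exprSr invfM mulrA mulfK// expf_neq0// gt_eqF.
split=> //.
  have E : g = 1 + 2 * ((g - 1) / 2) by field.
  have := @lattice_count_abs_body_le R n.+1 (c * m) ((g - 1) / 2) m _ m0.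
  rewrite -E -/b => hb; rewrite CE ler_pdivrMr// mulrDl divfK ?gt_eqF//.
  have -> : g + 2 * n.+1%:R / m%:R = 1 + 2 * ((g - 1) / 2 + n.+1%:R / m%:R).
    by rewrite {1}E; ring.
  rewrite chi_legendre_sum [_`!%:R * _]mulrC mulfK ?pnatr_eq0 -?lt0n ?fact_gt0//.
  rewrite addrA; apply: (@le_trans _ _ (`|\det (edge_mx x)| * b + C * m%:R ^+ n)); first lra.
  by rewrite lerD2r -mulrA ler_wpM2l// mulrC hb// divr_ge0// subr_ge0.
move=> gE; rewrite CE ler_pdivlMr// mulrBl divfK ?gt_eqF//.
have hb : m%:R ^+ n.+1 / (n.+1)`!%:R <= b.
  by rewrite /b gE lattice_count_abs_body_ge// leq_pmull.
have := ler_wpM2l (normr_ge0 (\det (edge_mx x))) hb.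
rewrite mulrA mulrAC; lra.
Qed.

Lemma in_box_dilate n (K : set 'rV[R]_n) (m : nat) : (0 < m)%N -> in_box 1 K ->
  in_box m%:R [set z | K (m%:R^-1 *: z)].
Proof.
move=> m0 bK z /= /bK zb i; have mR : 0 < m%:R :> R by rewrite ltr0n.
have := zb i; rewrite mxE normrM gtr0_norm ?invr_gt0//.
by rewrite mulrC ler_pdivrMr// mul1r.
Qed.

Lemma cvg_invn : (fun m : nat => m%:R^-1 : R) @ \oo --> 0.
Proof. by rewrite -cvg_shiftS; exact: cvg_harmonic. Qed.

Lemma chi1 n : (chi R n).[1] = 1.
Proof.
have := chi_legendre_sum n (0 : R); rewrite mulr0 addr0 => ->.
rewrite /legendre_sum big_ord_recl big1 => [|k _].
  rewrite /pow_fact bin0 expr0 fact0 !addr0 expr1n subn0 !mul1r invr1 mul1r.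
  by rewrite mulfV// pnatr_eq0 -lt0n fact_gt0.
by rewrite /pow_fact /= expr0n mul0r mulr0 mul0r.
Qed.

Lemma cvg_chi_bound n (a C b g : R) :
  (fun m : nat => a * ((chi R n).[g + b * m%:R^-1] / n`!%:R) + C * m%:R^-1) @ \oo
     --> a * ((chi R n).[g] / n`!%:R).
Proof.
rewrite -[X in _ --> X]addr0; apply: cvgD; last first.
  by rewrite -[X in _ --> X](mulr0 C); apply: cvgM; [exact: cvg_cst|exact: cvg_invn].
apply: cvgM; first exact: cvg_cst.
apply: cvgM; last exact: cvg_cst.
have h : (fun m : nat => g + b * m%:R^-1) @ \oo --> g.
  rewrite -[X in _ --> X]addr0; apply: cvgD; first exact: cvg_cst.
  by rewrite -[X in _ --> X](mulr0 b); apply: cvgM; [exact: cvg_cst|exact: cvg_invn].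
exact: (cvg_comp _ _ h (@continuous_horner _ (chi R n) g)).
Qed.

(** The simplex is the body with g = 1, and chi(1) = 1 makes the two bounds of [bary_body_count]
    converge to the same limit. *)
Lemma vol_simplex_hull n (x : 'I_n.+2 -> 'rV[R]_n.+1) :
  \det (vertex_matrix x) != 0 -> in_box 1 (simplex_hull x) ->
  vol (simplex_hull x) = `|\det (vertex_matrix x)| / (n.+1)`!%:R.
Proof.
move=> d0; rewrite simplex_hull_bary => bS.
have [C [c [c0 hC]]] := bary_body_count d0 (lexx 1).
apply: cvg_lim => //.
apply: (@squeeze_cvgr _ _ _ _ (fun m => `|\det (vertex_matrix x)| / (n.+1)`!%:R - C * m%:R^-1)
  (fun m => `|\det (vertex_matrix x)| *
    ((chi R n.+1).[1 + 2 * n.+1%:R * m%:R^-1] / (n.+1)`!%:R) + C * m%:R^-1)).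
- near=> m; have m0 : (0 < m)%N by near: m; exact: nbhs_infty_gt.
  have [bK hu hl] := hC m m0; rewrite grid_count_lattice.
  rewrite -(@lattice_count_widen _ m (c * m)) ?leq_pmull//; first by rewrite hl// hu.
  exact: in_box_dilate.
- rewrite -[X in _ --> X]subr0; apply: cvgB; first exact: cvg_cst.
  by rewrite -[X in _ --> X](mulr0 C); apply: cvgM; [exact: cvg_cst|exact: cvg_invn].
- have := @cvg_chi_bound n.+1 `|\det (vertex_matrix x)| C (2 * n.+1%:R) 1.
  by rewrite chi1 mul1r.
Unshelve. all: by end_near. Qed.

Lemma unit_ball_entry n (y : 'rV[R]_n) : unit_ball n y -> forall i, `|y 0 i| <= 1.
Proof.
move=> By i; rewrite -(@expr_le1 _ 2)// -normrX ger0_norm ?sqr_ge0//.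
apply: le_trans By; rewrite (bigD1 i)//= lerDl sumr_ge0// => j _; exact: sqr_ge0.
Qed.

(* If the counting limit did not exist, the volume would be the junk value 0. *)
Lemma kappa_ge0 n : 0 <= kappa R n.
Proof.
rewrite /kappa /vol; have [cv|ncv] := pselect (cvgn (fun m : nat =>
  ((grid_count (@unit_ball R n) m)%:R / (m%:R ^+ n) : R))); last by rewrite dvgP.
by apply: limr_ge => //; near=> m; rewrite divr_ge0 ?exprn_ge0.
Unshelve. all: by end_near. Qed.

Lemma kappa_le n (x : 'I_n.+2 -> 'rV[R]_n.+1) (g : R) :
  \det (vertex_matrix x) != 0 -> 1 <= g -> (chi R n.+1).[g] >= 0 ->
  unit_ball n.+1 `<=` bary_body x g ->
  kappa R n.+1 <= `|\det (vertex_matrix x)| * ((chi R n.+1).[g] / (n.+1)`!%:R).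
Proof.
move=> d0 g1 chi0 sub.
rewrite /kappa /vol; have [cv|ncv] := pselect (cvgn (fun m : nat =>
  ((grid_count (@unit_ball R n.+1) m)%:R / (m%:R ^+ n.+1) : R))); last first.
  by rewrite dvgP// mulr_ge0// divr_ge0.
have [C [c [c0 hC]]] := bary_body_count d0 g1.
apply: (ler_cvg_to cv (@cvg_chi_bound n.+1 `|\det (vertex_matrix x)| C (2 * n.+1%:R) g)).
near=> m; have m0 : (0 < m)%N by near: m; exact: nbhs_infty_gt.
have [bK hu _] := hC m m0; apply: le_trans hu; rewrite grid_count_lattice.
rewrite ler_pM2r ?invr_gt0 ?exprn_gt0 ?ltr0n//.
rewrite -(@lattice_count_widen _ m (c * m)) ?leq_pmull//.
  apply: ler_sum => k _; rewrite ler_nat; case: asboolP => //= /sub h.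
  by rewrite asboolT.
by apply: in_box_dilate => // y; exact: unit_ball_entry.
Unshelve. all: by end_near. Qed.

End Volumes.

(** * Hadamard's inequality and the regular simplex *)

Section RegularSimplex.
Variable R : realType.

(* Induction through the Schur complement of the upper left entry. *)
Lemma det_posdef_le n (G : 'M[R]_n) : G^T = G ->
  (forall v : 'rV[R]_n, v != 0 -> 0 < (v *m G *m v^T) 0 0) ->
  0 < \det G <= \prod_i G i i.
Proof.
elim: n G => [|n IH] G sG pG; first by rewrite det_mx00 big_ord0 ltr01 lexx.
rewrite -[n.+1]/(1 + n)%N in G sG pG *.
pose a := G 0 0; pose b := ursubmx G; pose C := drsubmx G.
have delta_form m (H : 'M[R]_m) i :
    ((delta_mx 0 i : 'rV[R]_m) *m H *m (delta_mx 0 i : 'rV[R]_m)^T) 0 0 = H i i.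
  by rewrite -rowE trmx_delta -colE !mxE.
have delta_neq0 m (i : 'I_m) : delta_mx (0 : 'I_1) i != 0 :> 'rV[R]_m.
  by apply/eqP => /matrixP /(_ 0 i); rewrite !mxE !eqxx => /eqP; rewrite oner_eq0.
have a0 : 0 < a by rewrite /a -delta_form pG.
have an0 := lt0r_neq0 a0.
have aE : ulsubmx G = a%:M.
  by rewrite [LHS]mx11_scalar; congr (_%:M); rewrite !mxE; congr (G _ _); apply: val_inj.
have bT : dlsubmx G = b^T by rewrite -[G in LHS]sG -trmx_ursub.
have GE : G = block_mx a%:M b b^T C by rewrite -aE -bT submxK.
pose S := C - a^-1 *: (b^T *m b).
have dG : \det G = a * \det S.
  have -> : G = block_mx 1%:M 0 (a^-1 *: b^T) 1%:M *m block_mx a%:M b 0 S.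
    rewrite mulmx_block !mul1mx !mul0mx !addr0 [LHS]GE -scalemxAl mul_mx_scalar scalerA.
    by rewrite mulVf// scale1r -scalemxAl /S addrC subrK.
  by rewrite det_mulmx det_lblock det_ublock !det1 !mul1r det_scalar1.
have sC : C^T = C by rewrite /C trmx_drsub sG.
have sS : S^T = S.
  by rewrite /S linearB linearZ /= trmx_mul trmxK sC.
have pS (w : 'rV[R]_n) : w != 0 -> 0 < (w *m S *m w^T) 0 0.
  (* The first entry of v is chosen to make the first entry of v G vanish, so that the form of G at
     v equals the form of S at w. *)
  move=> w0; pose v := row_mx (- (a^-1 *: (w *m b^T))) w.
  have vG : v *m G = row_mx 0 (w *m S).
    rewrite GE mul_row_block mul_mx_scalar scalerN scalerA mulfV// scale1r addNr.
    by rewrite mulNmx -scalemxAl addrC -mulmxA scalemxAr -mulmxBr.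
  have v0 : v != 0.
    by apply: contraNneq w0 => v0; rewrite -[w](row_mxKr (- (a^-1 *: (w *m b^T)))) -/v v0 linear0.
  have := pG v v0; rewrite vG tr_row_mx mul_row_col mul0mx add0r; exact.
have /andP[dS0 dSle] := IH S sS pS.
rewrite dG mulr_gt0//= big_ord_recl -/a ler_pM2l//.
apply: (le_trans dSle); apply: ler_prod => i _; apply/andP; split.
  by rewrite -delta_form ltW// pS.
rewrite !mxE big_ord_recl big_ord0 addr0 !mxE.
rewrite (_ : rshift 1 i = lift ord0 i); last by apply: val_inj.
by rewrite gerBl mulr_ge0 ?invr_ge0 ?(ltW a0)// -expr2 sqr_ge0.
Qed.

Lemma diag_form_gt0 n (w u : 'rV[R]_n) : (forall k, 0 < w 0 k) -> u != 0 ->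
  0 < (u *m diag_mx w *m u^T) 0 0.
Proof.
move=> w0 u0; have [k uk] : exists k, u 0 k != 0.
  apply/existsP; apply: contraNT u0; rewrite negb_exists => /forallP h.
  by apply/eqP/rowP => k; rewrite [RHS]mxE; apply/eqP; have := h k; rewrite negbK.
have -> : (u *m diag_mx w *m u^T) 0 0 = \sum_l u 0 l ^+ 2 * w 0 l.
  by rewrite mxE; apply: eq_bigr => l _; rewrite mul_mx_diag !mxE; ring.
rewrite (bigD1 k)//=; apply: ltr_pwDl.
  by rewrite pmulr_lgt0// exprn_even_gt0.
by apply: sumr_ge0 => l _; rewrite pmulr_lge0// sqr_ge0.
Qed.

Definition shifted_gram n (x : 'I_n.+1 -> 'rV[R]_n) : 'M[R]_n.+1 :=
  \matrix_(j, k) (\sum_i x j 0 i * x k 0 i + n%:R^-1).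

(* Scaling the last column of the vertex matrix by n^(-1/2) makes the rows of
   a regular inscribed simplex orthogonal. *)
Definition column_weight n : 'rV[R]_n.+1 :=
  \row_k (if k == ord_max then n%:R^-1 else 1).

Lemma shifted_gramE n (x : 'I_n.+1 -> 'rV[R]_n) :
  shifted_gram x = vertex_matrix x *m diag_mx (column_weight n) *m (vertex_matrix x)^T.
Proof.
apply/matrixP => j k; rewrite !mxE sum_lift_max.
rewrite mul_mx_diag !mxE unlift_none eqxx mul1r mulr1; congr (_ + _).
apply: eq_bigr => i _; rewrite !mxE liftK.
by rewrite eq_sym (negPf (neq_lift _ _)) mulr1.
Qed.

Lemma det_shifted_gram n (x : 'I_n.+1 -> 'rV[R]_n) :
  \det (shifted_gram x) = \det (vertex_matrix x) ^+ 2 / n%:R.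
Proof.
rewrite shifted_gramE !det_mulmx det_tr det_diag big_ord_recr big1 /=; last first.
  by move=> i _; rewrite mxE -val_eqE /= ltn_eqF.
by rewrite mxE eqxx mul1r; ring.
Qed.

(** Hadamard's inequality, with diagonal entries of the Gram matrix at most 1 + 1/(n+1) because the
    vertices lie in the ball. *)
Lemma det_vertex_le n (x : 'I_n.+2 -> 'rV[R]_n.+1) :
  (forall j, unit_ball n.+1 (x j)) -> \det (vertex_matrix x) != 0 ->
  \det (vertex_matrix x) ^+ 2 / n.+1%:R <= (1 + n.+1%:R^-1) ^+ n.+2.
Proof.
move=> Bx d0; rewrite -det_shifted_gram.
have sG : (shifted_gram x)^T = shifted_gram x.
  apply/matrixP => j k; rewrite !mxE; congr (_ + _).
  by apply: eq_bigr => i _; rewrite mulrC.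
have wpos k : 0 < column_weight n.+1 0 k.
  by rewrite mxE; case: ifP => _; rewrite ?ltr01// invr_gt0 ltr0n.
have pG (v : 'rV[R]_n.+2) : v != 0 -> 0 < (v *m shifted_gram x *m v^T) 0 0.
  move=> v0; pose u := v *m vertex_matrix x.
  have u0 : u != 0.
    apply: contraNneq v0 => u0; have uV : vertex_matrix x \in unitmx.
      by rewrite unitmxE unitfE.
    by rewrite -[v](mulmxK uV) -/u u0 mul0mx.
  have -> : v *m shifted_gram x *m v^T = u *m diag_mx (column_weight n.+1) *m u^T.
    by rewrite shifted_gramE /u trmx_mul !mulmxA.
  exact: diag_form_gt0.
have /andP[_ /le_trans] := det_posdef_le sG pG; apply.
rewrite -[X in _ ^+ X]card_ord -prodr_const; apply: ler_prod => j _.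
rewrite mxE; under eq_bigr do rewrite -expr2; apply/andP; split.
  by rewrite addr_ge0 ?invr_ge0// sumr_ge0// => i _; apply: sqr_ge0.
by rewrite lerD2r; exact: Bx.
Qed.

(** Unit norms and equal distances give a common inner product c. The n + 2 vertices satisfy a
    linear relation v; pairing it with each vertex and summing yields (1 + (n+1) c) s = 0, where s
    is the sum of v, and s = 0 would force v = 0. *)
Lemma regular_inner n (x : 'I_n.+2 -> 'rV[R]_n.+1) : regular_inscribed x ->
  forall j k, j != k -> \sum_i x j 0 i * x k 0 i = - n.+1%:R^-1.
Proof.
move=> [x1 xd d0].
pose ip j k := \sum_i x j 0 i * x k 0 i.
have distE j k : \sum_i (x j 0 i - x k 0 i) ^+ 2 = 2 - 2 * ip j k.
  transitivity (\sum_i x j 0 i ^+ 2 + \sum_i x k 0 i ^+ 2 - 2 * ip j k).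
    by rewrite mulr_sumr -big_split -sumrB; apply: eq_bigr => i _ /=; ring.
  by rewrite !x1.
pose c := ip ord0 ord_max.
have ipE j k : j != k -> ip j k = c.
  move=> jk; have := xd j k ord0 ord_max jk isT.
  by rewrite !distE -/c; lra.
(* If c = 1, two vertices coincide and the determinant vanishes. *)
have c1 : 1 - c != 0.
  apply/negP => /eqP c1; move/eqP: d0; apply.
  apply: (@determinant_alternate _ _ _ ord0 ord_max) => // k.
  suff xx : x ord0 = x ord_max by rewrite !mxE xx.
  apply/rowP => i; apply/eqP; rewrite -subr_eq0 -sqrf_eq0; apply/eqP.
  have h : \sum_i (x ord0 0 i - x ord_max 0 i) ^+ 2 = 0 by rewrite distE -/c; lra.
  by apply: (psumr_eq0P _ h) => // l _; apply: sqr_ge0.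
pose X : 'M[R]_(n.+2, n.+1) := \matrix_j x j.
have : kermx X != 0.
  rewrite kermx_eq0 /row_free; apply/negP => /eqP rX.
  by have := rank_leq_col X; rewrite rX ltnn.
move=> /rowV0Pn [v /sub_kermxP vX v0].
pose s := \sum_j v 0 j.
have vE j : (1 - c) * v 0 j + c * s = 0.
  have sj : s = v 0 j + \sum_(k | k != j) v 0 k by rewrite /s (bigD1 j).
  have : (v *m X *m (x j)^T) 0 0 = 0 by rewrite vX mul0mx mxE.
  rewrite -mulmxA mxE (eq_bigr (fun k => v 0 k * ip k j)); last first.
    by move=> k _; rewrite mxE; congr (_ * _); apply: eq_bigr => i _; rewrite !mxE.
  rewrite (bigD1 j)//= (eq_bigr (fun k => v 0 k * c)); last by move=> k kj; rewrite ipE.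
  rewrite -mulr_suml sj.
  have -> : ip j j = 1 by rewrite -(x1 j); apply: eq_bigr => i _; rewrite expr2.
  move=> h; rewrite -[RHS]h; ring.
have sE : (1 - c) * s + n.+2%:R * (c * s) = 0.
  have : \sum_j ((1 - c) * v 0 j + c * s) = 0 by apply: big1.
  by rewrite big_split /= -mulr_sumr sumr_const card_ord -[_ *+ _]mulr_natl.
have s0 : s != 0.
  apply: contraNneq v0 => s0; apply/eqP/rowP => j; rewrite mxE.
  by have /eqP := vE j; rewrite s0 mulr0 addr0 mulf_eq0 (negPf c1) => /eqP.
move=> j k jk; rewrite -/(ip j k) ipE//.
have /eqP : (1 + n.+1%:R * c) * s = 0 by rewrite -sE -natr1; ring.
rewrite mulf_eq0 (negPf s0) orbF => /eqP h.
have n0 : n.+1%:R != 0 :> R by rewrite pnatr_eq0.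
by apply: (mulfI n0); rewrite mulrN mulfV//; lra.
Qed.

Lemma det_regular n (x : 'I_n.+2 -> 'rV[R]_n.+1) : regular_inscribed x ->
  \det (vertex_matrix x) ^+ 2 / n.+1%:R = (1 + n.+1%:R^-1) ^+ n.+2.
Proof.
move=> rx; have [x1 _ _] := rx; rewrite -det_shifted_gram.
have -> : shifted_gram x = (1 + n.+1%:R^-1)%:M.
  apply/matrixP => j k; rewrite !mxE; case: eqP => [->|/eqP jk].
    rewrite mulr1n; congr (_ + _); rewrite -[RHS](x1 k).
    by apply: eq_bigr => i _; rewrite expr2.
  by rewrite regular_inner// addNr.
by rewrite det_scalar.
Qed.

Lemma det_vertex_le_regular n (x xr : 'I_n.+2 -> 'rV[R]_n.+1) :
  (forall j, unit_ball n.+1 (x j)) -> \det (vertex_matrix x) != 0 ->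
  regular_inscribed xr -> `|\det (vertex_matrix x)| <= `|\det (vertex_matrix xr)|.
Proof.
move=> Bx d0 /det_regular rE; have := det_vertex_le Bx d0.
rewrite -rE ler_pM2r ?invr_gt0 ?ltr0n// => h.
by rewrite -(@ler_pXn2r _ 2) ?nnegrE// -!normrX !ger0_norm ?sqr_ge0.
Qed.

End RegularSimplex.

(** * The norm of the interpolation projector *)

Section InterpolationNorm.
Variable R : realType.

(** For a nondegenerate simplex these are the barycentric coordinates of y, that is, the values at y
    of the basic Lagrange polynomials. *)
Definition lagrange n (x : 'I_n.+1 -> 'rV[R]_n) (y : 'rV[R]_n) : 'rV[R]_n.+1 :=
  ext_row y *m invmx (vertex_matrix x).

Lemma interpE n (x : 'I_n.+1 -> 'rV[R]_n) f y :
  interp x f y = \sum_j lagrange x y 0 j * f (x j).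
Proof. by rewrite /interp mxE; apply: eq_bigr => j _; rewrite [X in _ * X]mxE. Qed.

Lemma lagrange_sum n (x : 'I_n.+1 -> 'rV[R]_n) y : \det (vertex_matrix x) != 0 ->
  \sum_j lagrange x y 0 j = 1 /\ y = \sum_j lagrange x y 0 j *: x j.
Proof.
move=> d0; have uV : vertex_matrix x \in unitmx by rewrite unitmxE unitfE.
have /rowP E : lagrange x y *m vertex_matrix x = ext_row y by rewrite mulmxKV.
split.
  have := E ord_max; rewrite [RHS]mxE unlift_none => <-; rewrite mxE.
  by apply: eq_bigr => j _; rewrite vertex_matrix_max mulr1.
apply/rowP => i; have := E (lift ord_max i); rewrite [RHS]mxE liftK => <-.
rewrite mxE summxE; apply: eq_bigr => j _.
by rewrite vertex_matrix_lift [RHS]mxE.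
Qed.

Lemma lagrange_node n (x : 'I_n.+1 -> 'rV[R]_n) i j : \det (vertex_matrix x) != 0 ->
  lagrange x (x i) 0 j = (i == j)%:R.
Proof.
move=> d0; have uV : vertex_matrix x \in unitmx by rewrite unitmxE unitfE.
have -> : lagrange x (x i) = row i (vertex_matrix x *m invmx (vertex_matrix x)).
  by rewrite row_mul rowK.
by rewrite mulmxV// !mxE.
Qed.

Lemma sum_continuous (T : topologicalType) (I : Type) (r : seq I) (F : I -> T -> R) :
  (forall i, continuous (F i)) -> continuous (fun y => \sum_(i <- r) F i y).
Proof. by move=> cF; apply: continuous_big => [|i _]; [exact: add_continuous|exact: cF]. Qed.

Lemma continuous_mulr_cst (T : topologicalType) (f : T -> R) c :
  continuous f -> continuous (fun y => f y * c).
Proof. by move=> cf y; apply: cvgM; [exact: cf|exact: cvg_cst]. Qed.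

Lemma lagrange_continuous n (x : 'I_n.+1 -> 'rV[R]_n) j :
  continuous (fun y => lagrange x y 0 j).
Proof.
have -> : (fun y => lagrange x y 0 j) =
    (fun y => \sum_k (if unlift ord_max k is Some k' then y 0 k' else 1)
      * invmx (vertex_matrix x) k j).
  by apply/funext => y; rewrite mxE; apply: eq_bigr => k _; rewrite [X in X * _]mxE.
apply: sum_continuous => k; apply: continuous_mulr_cst.
case: unlift => [k'|]; last exact: cst_continuous.
exact: coord_continuous.
Qed.

(** Truncation to [-1, 1], written with absolute values so that continuity is inherited from the
    norm. *)
Definition clamp1 (u : R) := (`|u + 1| - `|u - 1|) / 2.

Lemma clamp1_le u : `|clamp1 u| <= 1.
Proof.
rewrite /clamp1 ler_norml; case: (ler0P (u + 1)) => ?; case: (ler0P (u - 1)) => ?;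
  apply/andP; split; lra.
Qed.

Lemma clamp1_id u : `|u| <= 1 -> clamp1 u = u.
Proof.
rewrite /clamp1 ler_norml => /andP[? ?].
by case: (ler0P (u + 1)) => ?; case: (ler0P (u - 1)) => ?; lra.
Qed.

Lemma clamp1_continuous (T : topologicalType) (p : T -> R) :
  continuous p -> continuous (clamp1 \o p).
Proof.
move=> cp; apply: continuous_mulr_cst => y.
by apply: cvgB; apply: cvg_norm; [apply: cvgD|apply: cvgB]; try exact: cvg_cst; exact: cp.
Qed.

Lemma unit_ball_ext_row n (y : 'rV[R]_n) k : unit_ball n y -> `|(ext_row y) 0 k| <= 1.
Proof.
by move=> /unit_ball_entry yb; rewrite mxE; case: unlift => [i|]; rewrite ?normr1.
Qed.

(** The extremal function is the affine function p taking at each node the sign of the corresponding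
    barycentric coordinate of y, truncated to [-1, 1]; truncation does not change its values at the
    nodes. *)
Lemma lagrange_norm_le n (x : 'I_n.+1 -> 'rV[R]_n) y :
  (forall j, unit_ball n (x j)) -> \det (vertex_matrix x) != 0 -> unit_ball n y ->
  \sum_j `|lagrange x y 0 j| <= interp_norm x.
Proof.
move=> Bx d0 By; apply: ub_le_sup.
  (* The supremum is taken over a bounded set: the entries of [ext_row z] are at most 1 in absolute
     value. *)
  exists (\sum_(j < n.+1) entry_sum (invmx (vertex_matrix x))) => _ [f [z [_ f1 Bz ->]]].
  rewrite interpE; apply: (le_trans (ler_norm_sum _ _ _)); apply: ler_sum => j _.
  rewrite normrM -[leRHS]mulr1 ler_pM// ?f1//.
  rewrite -[leRHS]mulr1; apply: mulmx_entry_le => // k; exact: unit_ball_ext_row.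
pose s j : R := if 0 <= lagrange x y 0 j then 1 else -1.
pose p z := \sum_j lagrange x z 0 j * s j.
have s1 j : `|s j| <= 1 by rewrite /s; case: ifP; rewrite ?normrN normr1.
have px j : p (x j) = s j.
  rewrite /p (bigD1 j)//= lagrange_node// eqxx mul1r big1 ?addr0// => k kj.
  by rewrite lagrange_node// eq_sym (negPf kj) mul0r.
exists (clamp1 \o p), y; split=> //.
- apply: continuous_subspaceT; apply: clamp1_continuous.
  by apply: sum_continuous => j; apply: continuous_mulr_cst; exact: lagrange_continuous.
- by move=> z _; exact: clamp1_le.
rewrite interpE ger0_norm; last first.
  apply: sumr_ge0 => j _; rewrite /= px clamp1_id// /s; case: ifPn => [h|]; first by rewrite mulr1.
  by rewrite -ltNge => /ltW; rewrite mulrN1 oppr_ge0.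
apply: eq_bigr => j _; rewrite /= px clamp1_id// /s; case: ifPn => [h|].
  by rewrite mulr1 ger0_norm.
by rewrite -ltNge mulrN1 => /ltr0_norm.
Qed.

Lemma interp_norm_ge1 n (x : 'I_n.+1 -> 'rV[R]_n) :
  (forall j, unit_ball n (x j)) -> \det (vertex_matrix x) != 0 -> 1 <= interp_norm x.
Proof.
move=> Bx d0; apply: le_trans (lagrange_norm_le Bx d0 (Bx ord0)).
have [l1 _] := lagrange_sum (x ord0) d0.
by rewrite -[leLHS](normr1 R) -{1}l1 ler_norm_sum.
Qed.

Lemma kappa_le_interp_norm n (x : 'I_n.+2 -> 'rV[R]_n.+1) :
  (forall j, unit_ball n.+1 (x j)) -> \det (vertex_matrix x) != 0 ->
  (n.+1)`!%:R * kappa R n.+1 / `|\det (vertex_matrix x)| <= (chi R n.+1).[interp_norm x].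
Proof.
move=> Bx d0; have N1 := interp_norm_ge1 Bx d0.
have chi0 : 0 <= (chi R n.+1).[interp_norm x].
  move: N1; rewrite le_eqVlt => /orP[/eqP <-|N1]; first by rewrite chi1.
  by rewrite ltW// (lt_trans ltr01)// -(chi1 R n.+1) chi_lt.
have f0 : 0 < (n.+1)`!%:R :> R by rewrite ltr0n fact_gt0.
have kle := kappa_le d0 N1 chi0 _.
rewrite ler_pdivrMr ?normr_gt0//; apply: le_trans (ler_wpM2l (ltW f0) (kle _)) _.
  (* The barycentric coordinates of y witness that the ball lies in E_g with g the projector
     norm. *)
  move=> y By; have [l1 yE] := lagrange_sum y d0.
  by exists (lagrange x y 0); split=> //; exact: lagrange_norm_le.
by rewrite mulrCA [X in _ * X]mulrC divfK ?gt_eqF// mulrC.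
Qed.

Lemma chi_inv_le n (s N : R) : (0 < n)%N -> 1 <= N -> s <= (chi R n).[N] -> chi_inv n s <= N.
Proof.
move=> n0 N1 sN; rewrite /chi_inv.
(* For s < 1 the set is empty and [sup] takes its default value 0. *)
have [->|/set0P ne] := eqVneq [set t | 1 <= t /\ (chi R n).[t] <= s] set0.
  by rewrite sup0 (le_trans ler01).
apply: ge_sup => // t [t1 ts]; rewrite leNgt; apply/negP => Nt.
have := lt_le_trans (chi_lt n0 N1 Nt) (le_trans ts sN); by rewrite ltxx.
Qed.

Lemma simplex_hull_in_box n (x : 'I_n.+1 -> 'rV[R]_n) :
  (forall j, unit_ball n (x j)) -> in_box 1 (simplex_hull x).
Proof.
move=> Bx _ [l [l0 l1 ->]] i; rewrite summxE (le_trans (ler_norm_sum _ _ _))// -l1.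
apply: ler_sum => j _; rewrite mxE normrM ger0_norm// ler_piMr//.
exact: unit_ball_entry.
Qed.

Lemma kappa_div_vol n (x : 'I_n.+2 -> 'rV[R]_n.+1) :
  (forall j, unit_ball n.+1 (x j)) -> \det (vertex_matrix x) != 0 ->
  kappa R n.+1 / vol (simplex_hull x)
    = (n.+1)`!%:R * kappa R n.+1 / `|\det (vertex_matrix x)|.
Proof.
move=> Bx d0; rewrite vol_simplex_hull//; last exact: simplex_hull_in_box.
by rewrite invfM invrK mulrA mulrAC [_ * kappa _ _]mulrC.
Qed.

End InterpolationNorm.

Unset Implicit Arguments.

Theorem theorem11p3 (R : realType) (n : nat) : (0 < n)%N ->
  (forall x : 'I_n.+1 -> 'rV[R]_n,
     (forall j, unit_ball n (x j)) -> \det (vertex_matrix x) != 0 ->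
     chi_inv n (kappa R n / vol (simplex_hull x)) <= interp_norm x /\
     kappa R n / vol (simplex_hull x)
       = (n`!)%:R * kappa R n / `|\det (vertex_matrix x)|) /\
  (forall xr : 'I_n.+1 -> 'rV[R]_n, regular_inscribed xr ->
     chi_inv n (kappa R n / vol (simplex_hull xr)) <= theta R n).
Proof.
case: n => // n n0; split=> [x Bx d0|xr rx].
  split; last exact: kappa_div_vol.
  rewrite kappa_div_vol//; apply: chi_inv_le => //; first exact: interp_norm_ge1.
  exact: kappa_le_interp_norm.
have [xr1 _ dr0] := rx.
have Bxr j : unit_ball n.+1 (xr j) by rewrite /unit_ball /= xr1.
(* The regular simplex itself shows that the infimum is over a nonempty set. *)
apply: lb_le_inf; first by exists (interp_norm xr), xr.
move=> _ [x [Bx d0 ->]]; apply: chi_inv_le => //; first exact: interp_norm_ge1.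
apply: le_trans (kappa_le_interp_norm Bx d0); rewrite kappa_div_vol//.
(* Maximality of the regular determinant makes its quotient the smallest. *)
apply: ler_wpM2l; first by rewrite mulr_ge0 ?kappa_ge0.
by rewrite lef_pV2 ?posrE ?normr_gt0// det_vertex_le_regular.
Qed.
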